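(* Let $p\in(0,1)$ and $b>0$ be fixed, let $q:(0,\infty)\to(0,1)$ be the function such that, for each $a>0$, $q(a)$ is the unique element of $(0,1)$ satisfying $$\int_0^{q(a)} t^{a-1}(1-t)^{b-1}\,dt = p\int_0^1 t^{a-1}(1-t)^{b-1}\,dt ,$$ and let $\phi(a):=-a\log q(a)$ for $a>0$. Then $\phi$ is real analytic on $(0,\infty)$. It is decreasing if $b<1$, constant if $b=1$, and increasing if $b>1$. It has limits $$\lim_{a\to 0}\phi(a)=-\log p\qquad\text{and}\qquad \lim_{a\to\infty}\phi(a)=\gamma_b ,$$ where $\gamma_b$ is the $(1-p)$-quantile of the gamma distribution with parameter $b$.
   Context: The gamma distribution with parameter $b$ is the probability distribution on $(0,\infty)$ with density $x\mapsto e^{-x}x^{b-1}/\int_0^\infty e^{-s}s^{b-1}\,ds$. For $r\in(0,1)$, an $r$-quantile of a distribution with cumulative distribution function $F$ is a value $x$ with $F(x)=r$; thus $\gamma_b$ is the unique positive number with $\int_0^{\gamma_b}e^{-s}s^{b-1}\,ds=(1-p)\Gamma(b)$. ''Increasing'' and ''decreasing'' are understood in the non-strict sense unless ''strictly'' is said. *)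

(* Defs.v *)
From HB Require Import structures.
From mathcomp Require Import all_boot all_order all_algebra.
From mathcomp Require Import all_classical all_reals all_analysis.
Set Implicit Arguments.
Unset Strict Implicit.
Unset Printing Implicit Defensive.
Import Order.TTheory GRing.Theory Num.Theory.
Import numFieldNormedType.Exports.
Local Open Scope classical_set_scope.
Local Open Scope ring_scope.

Definition real_analytic_at (R : realType) (f : R -> R) (x0 : R) : Prop :=
  exists c : R^nat, \forall x \near x0, pseries c (x - x0) @ \oo --> f x.

Definition real_analytic_on (R : realType) (D : set R) (f : R -> R) : Prop :=
  forall x, D x -> real_analytic_at f x.

(* The integrand is nonnegative, so its extended-real Lebesgue integral agrees
   with the (possibly improper) Riemann integral; the open interval keeps the
   library value 0 `^ 0 = 1 and the convention for powers of negative numbers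
   out of play. *)
Definition incomplete_beta (R : realType) (a b x : R) : \bar R :=
  (\int[@lebesgue_measure R]_(t in `]0%R, x[)
     (t `^ (a - 1) * (1 - t) `^ (b - 1))%:E)%E.

Definition gamma_fun (R : realType) (b : R) : R :=
  \int[@lebesgue_measure R]_(s in `]0, +oo[) (expR (- s) * s `^ (b - 1)).

Definition gamma_pdf (R : realType) (b x : R) : R :=
  if 0 < x then expR (- x) * x `^ (b - 1) / gamma_fun b else 0.

Definition gamma_prob (R : realType) (b : R) (A : set R) : \bar R :=
  (\int[@lebesgue_measure R]_(x in A) (gamma_pdf b x)%:E)%E.

(* [P] is a distribution on the line, given by its values on sets;
   [P `]-oo, x]] is its cumulative distribution function at [x]. *)
Definition is_quantile (R : realType) (P : set R -> \bar R) (r x : R) : Prop :=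
  P `]-oo, x]%classic = r%:E.

(* Main.v *)
Require Import Defs.
From mathcomp Require Import all_boot all_order all_algebra.
From mathcomp Require Import all_classical all_reals all_analysis.
From mathcomp Require Import measurable_realfun.
From mathcomp Require Import lra ring.
Import Order.TTheory GRing.Theory Num.Theory.
Import numFieldNormedType.Exports.
Set Implicit Arguments.
Unset Strict Implicit.
Unset Printing Implicit Defensive.
Local Open Scope classical_set_scope.
Local Open Scope ring_scope.

(** Write [ibeta b a x] for the integral of [t `^ (a - 1) * (1 - t) `^ (b - 1)]
    over [0 < t < x]; the quantile [q a] solves [ibeta b a (q a) = p * ibeta b a 1].

    Analyticity is an analytic implicit function theorem, proved by iteration. Put
    [w = - ln q], so that [phi a = a * w a], and expand at [a = a0 + h]. The
    functions of [h] with a power series of bounded weighted l1 norm (predicate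
    [wiener r M]) form an algebra that is closed under exponentials, under integrals
    over a parameter ([wiener_int]) and, the main point, under pointwise limits with
    bounded norms ([wiener_lim]). The map [a |-> ibeta b a x] lies in it
    ([ibeta_wiener]), and the simplified Newton iteration for [w] preserves a ball
    of it ([newton_map_wiener]). For each fixed [h] the iteration is a real
    contraction, so the iterates converge pointwise, and their limit [w] is analytic
    ([quantile_analytic]).

    Monotonicity is a likelihood ratio argument. For [a = r * a'] with [r <= 1], the
    substitution [t = x `^ r] turns the law with parameter [a'] into one whose density
    ratio to the law with parameter [a] is, up to a factor, the power [b - 1] of the
    chord slope [(1 - x `^ r) / (1 - x)]. The slope decreases in [x] by concavity, so
    the sign of [b - 1] orders the two laws, hence [q a `^ a] and [q a' `^ a']. For
    [b = 1] both orders hold and [phi] is constant.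

    The limits come from explicit comparisons with error [O(a)] as [a] tends to [0],
    where [a * ibeta b a x] is close to [x `^ a] ([ibeta_small_shape]), and [O(1 / a)]
    as [a] tends to infinity, where [a `^ b * ibeta b a (expR (- (y / a)))] is close to
    the upper incomplete gamma integral at [y] ([ibeta_large_shape]). Both say that
    two functions on an interval have nearly proportional derivatives. *)

(** * Balls of the weighted Wiener algebra *)

(** The closed ball of radius [M] in the weighted Wiener algebra of the disk
    [`|h| < r]. The norm is bounded through all its partial sums, which is a closed
    condition on the coefficients. *)
Definition wiener (R : realType) (r M : R) (f : R -> R) : Prop :=
  exists c : R^nat, (forall n, \sum_(i < n) `|c i| * r ^+ i <= M) /\
    forall h, `|h| < r -> pseries c h @ \oo --> f h.

Lemma wiener_analytic (R : realType) (r M x0 : R) (f : R -> R) : 0 < r ->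
  wiener r M (fun h => f (x0 + h)) -> real_analytic_at f x0.
Proof.
move=> r0 [c [_ cf]]; exists c; near=> x.
have : `|x - x0| < r by near: x; exact: cvgr_distC_lt.
by move=> /cf; rewrite [x0 + _]addrC subrK.
Unshelve. all: by end_near. Qed.

Lemma wiener_ext (R : realType) (r M : R) (f g : R -> R) :
  (forall h, `|h| < r -> f h = g h) -> wiener r M f -> wiener r M g.
Proof.
by move=> fg [c [cM cf]]; exists c; split=> // h hr; rewrite -fg//; exact: cf.
Qed.

Lemma wiener_le (R : realType) (r M M' : R) (f : R -> R) :
  M <= M' -> wiener r M f -> wiener r M' f.
Proof.
move=> MM' [c [cM cf]]; exists c; split=> // n; exact: le_trans MM'.
Qed.

Lemma wiener_ge0 (R : realType) (r M : R) (f : R -> R) :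
  wiener r M f -> 0 <= M.
Proof. by move=> [c [/(_ 0)]]; rewrite big_ord0. Qed.

(** The remainder is bounded through [M] alone, uniformly over the ball: this is what
    lets limits be exchanged with the summation of the series. *)
Lemma wiener_tail (R : realType) (r M : R) (f : R -> R) (c : R^nat) : 0 < r ->
  (forall n, \sum_(i < n) `|c i| * r ^+ i <= M) ->
  (forall h, `|h| < r -> pseries c h @ \oo --> f h) ->
  forall h N, `|h| < r ->
  `|f h - \sum_(i < N) c i * h ^+ i| <= M * (`|h| / r) ^+ N.
Proof.
move=> r0 cM cf h N hr.
have hr1 : `|h| / r <= 1 by rewrite ler_pdivrMr// mul1r ltW.
have hr0 : 0 <= `|h| / r by rewrite divr_ge0// ltW.
have cv : (fun n => `|pseries c h n - \sum_(i < N) c i * h ^+ i|) @ \oo -->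
   `|f h - \sum_(i < N) c i * h ^+ i|.
  by apply: cvg_norm; apply: cvgB; [exact: cf|exact: cvg_cst].
apply: cvgr_to_le cv _.
near=> n.
have Nn : (N <= n)%N by near: n; exact: nbhs_infty_ge.
rewrite /pseries /series/= -(big_mkord xpredT (fun i => c i * h ^+ i)).
rewrite (big_cat_nat (n := N) (p := n))//= [X in X - _]addrC addrK.
apply: (le_trans (ler_norm_sum _ _ _)).
apply: (@le_trans _ _ (\sum_(N <= i < n) `|c i| * r ^+ i * (`|h| / r) ^+ N)).
  rewrite big_nat_cond [leRHS]big_nat_cond; apply: ler_sum => i.
  rewrite andbT => /andP[Ni ni]; rewrite normrM normrX -mulrA ler_wpM2l//.
  have -> : `|h| ^+ i = r ^+ i * (`|h| / r) ^+ i.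
    by rewrite -exprMn mulrCA mulfV ?gt_eqF// mulr1.
  by rewrite ler_wpM2l ?exprn_ge0 ?(ltW r0)//; exact: ler_wiXn2l.
rewrite -mulr_suml ler_wpM2r ?exprn_ge0//.
apply: le_trans (cM n); rewrite -(big_mkord xpredT (fun i => `|c i| * r ^+ i)).
rewrite [leRHS](big_cat_nat (n := N))//= lerDr sumr_ge0// => i _.
by rewrite mulr_ge0 ?exprn_ge0 ?(ltW r0).
Unshelve. all: by end_near. Qed.

Lemma wiener_bound (R : realType) (r M : R) (f : R -> R) (h : R) :
  wiener r M f -> `|h| < r -> `|f h| <= M.
Proof.
move=> [c [cM cf]] hr; have r0 : 0 < r by exact: le_lt_trans hr.
have := wiener_tail r0 cM cf 0 hr.
by rewrite big_ord0 subr0 expr0 mulr1.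
Qed.

Lemma cvgr_sum (R : realType) (T I : Type) (F : set_system T) (s : seq I)
    (f : T -> I -> R) (l : I -> R) : Filter F ->
  (forall i, f x i @[x --> F] --> l i) ->
  (\sum_(i <- s) f x i) @[x --> F] --> \sum_(i <- s) l i.
Proof.
move=> FF fl; elim: s => [|i s IHs].
  by rewrite big_nil; under eq_fun do rewrite big_nil; exact: cvg_cst.
rewrite big_cons; under eq_fun do rewrite big_cons.
by apply: cvgD => //; exact: fl.
Qed.

(** The image of an ultrafilter clusters in a compact segment, and an ultrafilter
    converges to each of its cluster points. *)
Lemma bounded_ultra_cvg (R : realType) (U : set_system nat) (u : R^nat) (B : R) :
  UltraFilter U -> (forall n, `|u n| <= B) -> cvg (u @ U).
Proof.
move=> UU uB.
have UP : ProperFilter U := @ultra_proper _ _ UU.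
have : (u @ U) `[- B, B]%classic.
  by apply: (@filterE nat U) => n /=; rewrite in_itv/= -ler_norml.
move=> /(@segment_compact _ (- B) B _ _)[p [_ clp]].
apply/cvg_ex; exists p => V Vp.
have [//|nV] := in_ultra_setVsetC (u @^-1` V) UU.
have [x [+ ]] := clp (~` V) V nV Vp.
by [].
Qed.

(** A Montel theorem. Along an ultrafilter finer than [\oo] all coefficients
    converge at once, being bounded (this replaces a diagonal extraction); the bounds
    on partial sums and on remainders pass to the limit. *)
Lemma wiener_lim (R : realType) (r M : R) (m : R^nat) (f : R -> R)
    (g : nat -> R -> R) : 0 < r ->
  (forall n, wiener r (m n) (g n)) -> m @ \oo --> M ->
  (forall h, `|h| < r -> g n h @[n --> \oo] --> f h) -> wiener r M f.
Proof.
move=> r0 gw mM gf.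
have /choice[c cP] n := gw n.
have [U [UU oU]] := @ultraFilterLemma _ \oo _.
have UP : ProperFilter U := @ultra_proper _ _ UU.
have [B mB] : exists B, forall n, m n <= B.
  have [B [_ /(_ (B + 1))]] := cvg_seq_bounded (cvgP _ mM).
  rewrite ltrDl ltr01 => /(_ isT) mB; exists (B + 1) => n.
  by rewrite (le_trans (ler_norm _))// mB.
have cb n i : `|c n i| <= B / r ^+ i.
  rewrite ler_pdivlMr ?exprn_gt0//; apply: le_trans (mB n).
  have [cM _] := cP n; apply: le_trans (cM i.+1).
  rewrite big_ord_recr/= lerDr sumr_ge0// => j _.
  by rewrite mulr_ge0 ?exprn_ge0 ?(ltW r0).
have cc i : (fun n => c n i) @ U --> lim ((fun n => c n i) @ U).
  exact: bounded_ultra_cvg (cb^~ i).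
pose d i := lim ((fun n => c n i) @ U).
exists d; split=> [n|h hr].
  have mU : m @ U --> M by apply: cvg_trans mM; exact: cvg_app.
  have sU : (fun k => \sum_(i < n) `|c k i| * r ^+ i) @ U -->
      \sum_(i < n) `|d i| * r ^+ i.
    apply: cvgr_sum => i; apply: cvgMl; apply: cvg_norm; exact: cc.
  apply: ler_cvg_to sU mU _; apply: filterE => k; exact: (cP k).1.
have tl N : `|f h - \sum_(i < N) d i * h ^+ i| <= B * (`|h| / r) ^+ N.
  have gU : (fun k => `|g k h - \sum_(i < N) c k i * h ^+ i|) @ U -->
      `|f h - \sum_(i < N) d i * h ^+ i|.
    apply: cvg_norm; apply: cvgB.
      by apply: cvg_trans (gf h hr); exact: cvg_app.
    by apply: cvgr_sum => i; apply: cvgMl; exact: cc.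
  apply: cvgr_to_le gU _; apply: filterE => k.
  have [cM cf] := cP k.
  apply: le_trans (wiener_tail r0 cM cf N hr) _.
  by rewrite ler_wpM2r ?exprn_ge0 ?divr_ge0 ?(ltW r0).
have geo : (fun N => B * (`|h| / r) ^+ N) @ \oo --> 0.
  rewrite -[0](mulr0 B); apply: cvgMr; apply: cvg_expr.
  by rewrite ger0_norm ?divr_ge0 ?(ltW r0)// ltr_pdivrMr// mul1r.
apply/cvgrPdist_le => e e0.
near=> N; rewrite /pseries/series/= big_mkord; apply: le_trans (tl N) _.
by near: N; exact: cvgr_le geo _ e0.
Unshelve. all: by end_near. Qed.

Lemma wiener_monom (R : realType) (r a : R) (k : nat) : 0 < r ->
  wiener r (`|a| * r ^+ k) (fun h => a * h ^+ k).
Proof.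
move=> r0; exists (fun i => if i == k then a else 0); split=> [n|h _].
  have [kn|nk] := ltnP k n.
    rewrite (bigD1 (Ordinal kn))//= eqxx big1 ?addr0// => i.
    rewrite -val_eqE/= => /negPf ->.
    by rewrite normr0 mul0r.
  rewrite big1 ?mulr_ge0 ?exprn_ge0 ?(ltW r0)// => i _.
  have /negPf -> : (i : nat) != k.
    by rewrite neq_ltn (leq_trans (ltn_ord i) nk).
  by rewrite normr0 mul0r.
apply: cvg_near_cst; near=> n.
have kn : (k < n)%N by near: n; exact: nbhs_infty_gt.
rewrite /pseries/series/= big_mkord (bigD1 (Ordinal kn))//= eqxx big1 ?addr0// => i.
by rewrite -val_eqE/= => /negPf ->; rewrite mul0r.
Unshelve. all: by end_near. Qed.

Lemma wiener_cst (R : realType) (r a : R) : 0 < r -> wiener r `|a| (fun=> a).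
Proof.
move=> /(@wiener_monom _ r a 0); rewrite expr0 mulr1.
by apply: wiener_ext => h _; rewrite expr0 mulr1.
Qed.

Lemma wiener_id (R : realType) (r : R) : 0 < r -> wiener r r id.
Proof.
move=> /(@wiener_monom _ r 1 1); rewrite expr1 normr1 mul1r.
by apply: wiener_ext => h _; rewrite expr1 mul1r.
Qed.

Lemma wienerD (R : realType) (r M N : R) (f g : R -> R) : 0 <= r ->
  wiener r M f -> wiener r N g -> wiener r (M + N) (fun h => f h + g h).
Proof.
move=> r0 [c [cM cf]] [d [dN dg]]; exists (fun i => c i + d i); split=> [n|h hr].
  apply: le_trans (lerD (cM n) (dN n)); rewrite -big_split/=.
  apply: ler_sum => i _; rewrite -mulrDl ler_wpM2r ?exprn_ge0//.
  exact: ler_normD.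
have -> : pseries (fun i => c i + d i) h = (fun n => pseries c h n + pseries d h n).
  apply/funext => n; rewrite /pseries/series/= -big_split/=.
  by apply: eq_bigr => i _; rewrite mulrDl.
by apply: cvgD; [exact: cf|exact: dg].
Qed.

Lemma wienerZ (R : realType) (r M a : R) (f : R -> R) :
  wiener r M f -> wiener r (`|a| * M) (fun h => a * f h).
Proof.
move=> [c [cM cf]]; exists (fun i => a * c i); split=> [n|h hr].
  apply: le_trans (ler_wpM2l (normr_ge0 a) (cM n)); rewrite mulr_sumr.
  by apply: ler_sum => i _; rewrite normrM mulrA.
have -> : pseries (fun i => a * c i) h = (fun n => a * pseries c h n).
  apply/funext => n; rewrite /pseries/series/= mulr_sumr.
  by apply: eq_bigr => i _; rewrite mulrA.
by apply: cvgMr; exact: cf.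
Qed.

Lemma wienerN (R : realType) (r M : R) (f : R -> R) :
  wiener r M f -> wiener r M (fun h => - f h).
Proof.
move=> /(wienerZ (-1)); rewrite normrN1 mul1r.
by apply: wiener_ext => h _; rewrite mulN1r.
Qed.

Lemma wienerB (R : realType) (r M N : R) (f g : R -> R) : 0 <= r ->
  wiener r M f -> wiener r N g -> wiener r (M + N) (fun h => f h - g h).
Proof. by move=> r0 fM /wienerN; exact: wienerD. Qed.

Lemma wiener_sum (R : realType) (r : R) (I : Type) (s : seq I) (M : I -> R)
    (f : I -> R -> R) : 0 < r -> (forall i, wiener r (M i) (f i)) ->
  wiener r (\sum_(i <- s) M i) (fun h => \sum_(i <- s) f i h).
Proof.
move=> r0 fM; elim: s => [|i s IHs].
  have := wiener_cst 0 r0; rewrite big_nil normr0.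
  by apply: wiener_ext => h _; rewrite big_nil.
rewrite big_cons; have := wienerD (ltW r0) (fM i) IHs.
by apply: wiener_ext => h _; rewrite big_cons.
Qed.

(** The products of the truncated series are polynomials in the ball of radius
    [M * N], and [wiener_lim] passes to the limit. *)
Lemma wienerM (R : realType) (r M N : R) (f g : R -> R) : 0 < r ->
  wiener r M f -> wiener r N g -> wiener r (M * N) (fun h => f h * g h).
Proof.
move=> r0 fM gN.
have M0 := wiener_ge0 fM; have N0 := wiener_ge0 gN.
case: fM gN => [c [cM cf]] [d [dN dg]].
pose p n h := (\sum_(i < n) c i * h ^+ i) * (\sum_(j < n) d j * h ^+ j).
apply: (@wiener_lim _ r _ (fun=> M * N) _ p) => //.
- move=> n; apply: (@wiener_le _ _ (\sum_(i < n) \sum_(j < n)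
      `|c i * d j| * r ^+ (i + j))).
    rewrite (_ : \sum_(i < n) _ = (\sum_(i < n) `|c i| * r ^+ i) *
       (\sum_(j < n) `|d j| * r ^+ j)); last first.
      rewrite mulr_suml; apply: eq_bigr => i _; rewrite mulr_sumr.
      by apply: eq_bigr => j _; rewrite normrM exprD mulrACA.
    by apply: ler_pM => //; apply: sumr_ge0 => i _;
      rewrite mulr_ge0 ?exprn_ge0 ?(ltW r0).
  apply: (@wiener_ext _ _ _ (fun h => \sum_(i < n) \sum_(j < n)
      c i * d j * h ^+ (i + j))).
    move=> h _; rewrite /p mulr_suml; apply: eq_bigr => i _; rewrite mulr_sumr.
    by apply: eq_bigr => j _; rewrite exprD mulrACA.
  by apply: wiener_sum => // i; apply: wiener_sum => // j; exact: wiener_monom.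
- exact: cvg_cst.
- move=> h hr; rewrite (_ : (p ^~ h) = (fun n => pseries c h n * pseries d h n)); last first.
    by apply/funext => n; rewrite /p /pseries /series/= !big_mkord.
  by apply: cvgM; [exact: cf|exact: dg].
Qed.

Lemma wienerX (R : realType) (r M : R) (f : R -> R) n : 0 < r ->
  wiener r M f -> wiener r (M ^+ n) (fun h => f h ^+ n).
Proof.
move=> r0 fM; elim: n => [|n IHn].
  have := wiener_cst 1 r0; rewrite normr1 expr0.
  by apply: wiener_ext => h _; rewrite expr0.
rewrite exprS; have := wienerM r0 fM IHn.
by apply: wiener_ext => h _; rewrite exprS.
Qed.

(** Without constant term, every term of the norm gains at least a factor [r' / r]. *)
Lemma wiener_vanish (R : realType) (r r' M : R) (f : R -> R) : 0 < r' <= r ->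
  wiener r M f -> f 0 = 0 -> wiener r' (M * (r' / r)) f.
Proof.
move=> /andP[r'0 r'r] [c [cM cf]] f0.
have r0 : 0 < r by exact: lt_le_trans r'r.
have c0 : c 0%N = 0.
  have := wiener_tail r0 cM cf 1%N; move=> /(_ 0).
  rewrite normr0 => /(_ r0).
  by rewrite big_ord1 f0 mulr1 mul0r expr0n/= mulr0 sub0r normrN normr_le0 => /eqP.
exists c; split=> [n|h hr]; last by apply: cf; exact: lt_le_trans r'r.
apply: (@le_trans _ _ ((\sum_(i < n) `|c i| * r ^+ i) * (r' / r))); last first.
  by rewrite ler_wpM2r// divr_ge0// ltW.
rewrite mulr_suml; apply: ler_sum => -[[|i] ni] _ /=.
  by rewrite c0 normr0 !mul0r.
rewrite -mulrA ler_wpM2l//.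
have -> : r ^+ i.+1 * (r' / r) = r ^+ i * r'.
  by rewrite exprSr; field; rewrite gt_eqF.
by rewrite exprSr ler_wpM2r ?(ltW r'0)// lerXn2r ?nnegrE ?(ltW r'0) ?(ltW r0).
Qed.

(** Used to make the first Newton correction small by shrinking the disk. *)
Lemma wiener_vanish_small (R : realType) (r s e M : R) (f : R -> R) :
  0 < r -> 0 < s -> 0 < e -> wiener r M f -> f 0 = 0 ->
  exists r', [/\ 0 < r', r' <= s & wiener r' e f].
Proof.
move=> r0 s0 e0 fM f0; have M0 := wiener_ge0 fM.
have M10 : 0 < M + 1 by rewrite ltr_wpDl.
pose d := e / (M + 1); have d0 : 0 < d by rewrite divr_gt0.
pose r' := Num.min s (r * Num.min 1 d).
have r'0 : 0 < r' by rewrite lt_min s0 mulr_gt0// lt_min ltr01.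
have r'r : r' <= r by rewrite ge_min ler_piMr ?ge_min ?lexx ?orbT// ltW.
exists r'; split; [by []|by rewrite ge_min lexx|].
have r'rr : 0 < r' <= r by rewrite r'0.
apply: (wiener_le _ (wiener_vanish r'rr fM f0)).
have r'd : r' / r <= d.
  rewrite ler_pdivrMr// ge_min [d * r]mulrC ler_pM2l// ge_min lexx !orbT//.
apply: (le_trans (ler_wpM2l M0 r'd)).
by rewrite mulrA ler_pdivrMr// mulrC ler_wpM2l ?(ltW e0)// lerDl.
Qed.

(** * Exponentials, inverses and integrals over a parameter *)

(** Dropping the constant term gives a bound that tends to [0] with [s]. *)
Lemma wiener_exp_sub1 (R : realType) (r s : R) (f : R -> R) : 0 < r ->
  wiener r s f -> wiener r (expR s - 1) (fun h => expR (f h) - 1).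
Proof.
move=> r0 fs.
have cvg_exp (x : R) :
    \sum_(i < n) (i.+1`!%:R)^-1 * x ^+ i.+1 @[n --> \oo] --> expR x - 1.
  have : (series (exp_coeff x) n.+1 - 1) @[n --> \oo] --> expR x - 1.
    apply: cvgB; last exact: cvg_cst.
    rewrite (cvg_shiftS (series (exp_coeff x))).
    exact: is_cvg_series_exp_coeff.
  apply: cvg_trans; apply: near_eq_cvg; apply: nearW => n.
  rewrite /series/= big_mkord big_ord_recl/= /exp_coeff/= expr0 fact0 divr1.
  by rewrite [1 + _]addrC addrK; apply: eq_bigr => i _; rewrite mulrC.
apply: (@wiener_lim _ r _ (fun n => \sum_(i < n) (i.+1`!%:R)^-1 * s ^+ i.+1) _
   (fun n h => \sum_(i < n) (i.+1`!%:R)^-1 * f h ^+ i.+1)) => //.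
- move=> n.
  apply: (@wiener_le _ _ (\sum_(i < n) `|(i.+1`!%:R)^-1| * s ^+ i.+1)).
    by apply: ler_sum => i _; rewrite ger0_norm.
  by apply: wiener_sum => // i; apply: wienerZ; exact: wienerX.
Qed.

Lemma wiener_exp (R : realType) (r s : R) (f : R -> R) : 0 < r ->
  wiener r s f -> wiener r (expR s) (fun h => expR (f h)).
Proof.
move=> r0 /(wiener_exp_sub1 r0)/(wienerD (ltW r0) (wiener_cst 1 r0)).
by rewrite normr1 addrC subrK; apply: wiener_ext => h _; rewrite addrC subrK.
Qed.

Lemma wiener_inv1D (R : realType) (r s : R) (f : R -> R) : 0 < r -> s < 1 ->
  wiener r s f -> wiener r (1 - s)^-1 (fun h => (1 + f h)^-1).
Proof.
move=> r0 s1 fs; have s0 := wiener_ge0 fs.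
have cvg_geo (x : R) : `|x| < 1 ->
    \sum_(i < n) x ^+ i @[n --> \oo] --> (1 - x)^-1.
  move=> x1; have := @cvg_geometric_series _ 1 x x1.
  rewrite mul1r; apply: cvg_trans; apply: near_eq_cvg; apply: nearW => n.
  by rewrite /series/= big_mkord; apply: eq_bigr => i _; rewrite mul1r.
apply: (@wiener_lim _ r _ (fun n => \sum_(i < n) s ^+ i) _
   (fun n h => \sum_(i < n) (- f h) ^+ i)) => //.
- by move=> n; apply: wiener_sum => // i; apply: wienerX => //; exact: wienerN.
- by apply: cvg_geo; rewrite ger0_norm.
- move=> h hr; rewrite -[f h in X in _ --> X]opprK; apply: cvg_geo.
  by rewrite normrN; apply: le_lt_trans s1; exact: wiener_bound hr.
Qed.

(** Continuity is two-sided at the end points as well: the integrands to which this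
    applies are continuous around the segment. *)
Definition primitive01 (R : realType) (F f : R -> R) : Prop :=
  forall t : R, 0 <= t <= 1 -> is_derive t 1 F (f t) /\ {for t, continuous f}.

(** On each piece the increment of [F] is a value of [f] at an intermediate point, by
    the mean value theorem; uniform continuity of [f] comes from the near-covering
    form of compactness. *)
Lemma riemann_sum_cvg (R : realType) (F f : R -> R) : primitive01 F f ->
  (\sum_(i < n.+1) f (i%:R / n.+1%:R) / n.+1%:R) @[n --> \oo] --> F 1 - F 0.
Proof.
move=> Ff; apply/cvgrPdist_le => e e0.
have unif : \forall n \near \oo, `[0, 1]%classic `<=`
    (fun x : R => forall y, `|x - y| <= n.+1%:R^-1 -> `|f x - f y| <= e).
  have /compact_near_coveringP := @segment_compact R 0 1.
  apply => x /=; rewrite in_itv/= => x01.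
  have [_ fx] := Ff x x01.
  have e20 : 0 < e / 2 by rewrite divr_gt0.
  have /cvgrPdist_le/(_ _ e20)/nbhs_ballP[d /= d0 fd] := fx.
  have d20 : 0 < d / 2 by rewrite divr_gt0.
  near=> x' n => y xy.
  have xx' : `|x - x'| < d / 2.
    by near: x'; exact: cvgr_dist_lt.
  have nd : n.+1%:R^-1 < d / 2 by near: n; exact: near_infty_natSinv_lt (PosNum d20).
  have xy' : `|x - y| < d.
    rewrite -(subrKA x') (le_lt_trans (ler_normD _ _))// [d]splitr ltrD//.
    exact: le_lt_trans nd.
  have xx'd : `|x - x'| < d by rewrite (lt_trans xx')// gtr_pMr// invf_lt1// ltr1n.
  rewrite -(subrKA (f x)) (le_trans (ler_normD _ _))// [e]splitr lerD//.
    by rewrite distrC; exact: fd.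
  exact: fd.
move: unif; apply: filterS => n nP.
have N0 : 0 < n.+1%:R :> R by rewrite ltr0n.
have -> : F 1 - F 0 =
    \sum_(i < n.+1) (F (i.+1%:R / n.+1%:R) - F (i%:R / n.+1%:R)).
  rewrite -(big_mkord xpredT (fun i => F (i.+1%:R / n.+1%:R) - F (i%:R / n.+1%:R))).
  by rewrite telescope_sumr// mul0r divff// gt_eqF.
rewrite -sumrB (le_trans (ler_norm_sum _ _ _))//.
apply: (@le_trans _ _ (\sum_(i < n.+1) e / n.+1%:R)); last first.
  by rewrite sumr_const card_ord -[leLHS]mulr_natr divfK// gt_eqF.
apply: ler_sum => -[i /= ni] _.
have i01 : 0 <= i%:R / n.+1%:R :> R by rewrite divr_ge0.
have i11 : i.+1%:R / n.+1%:R <= 1 :> R by rewrite ler_pdivrMr// mul1r ler_nat.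
have ii1 : i%:R / n.+1%:R < i.+1%:R / n.+1%:R :> R.
  by rewrite ltr_pM2r ?invr_gt0// ltr_nat.
have D (x : R) : x \in `](i%:R / n.+1%:R), (i.+1%:R / n.+1%:R)[ ->
    is_derive x 1 F (f x).
  rewrite in_itv/= => /andP[x0 x1]; apply: (Ff x _).1.
  by rewrite (le_trans i01 (ltW x0)) (le_trans (ltW x1) i11).
have [|x] := MVT ii1 D.
  apply: derivable_within_continuous => x; rewrite in_itv/= => /andP[x0 x1].
  have [|d _] := Ff x; last exact: ex_derive.
  by rewrite (le_trans i01 x0) (le_trans x1 i11).
rewrite in_itv/= => /andP[x0 x1] ->.
have id : i.+1%:R / n.+1%:R = i%:R / n.+1%:R + n.+1%:R^-1 :> R.
  by rewrite -addn1 natrD mulrDl mul1r.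
rewrite {1}id [_ + n.+1%:R^-1]addrC addrK -mulrBl normrM.
rewrite [`|n.+1%:R^-1|]ger0_norm ?invr_ge0// ler_pM2r ?invr_gt0//.
rewrite distrC; apply: nP.
  by rewrite /= in_itv/= i01 (le_trans (ltW (lt_trans x0 x1)))//.
by rewrite distrC ger0_norm ?subr_ge0 ?(ltW x0)// lerBlDl -id ltW.
Unshelve. all: by end_near. Qed.

(** The Riemann sums in [t] lie in balls whose radii are the Riemann sums of [m]. A
    variable bound [m] keeps the estimate sharp when the integrand is nearly
    singular. *)
Lemma wiener_int (R : realType) (r : R) (F f : R -> R -> R) (N m : R -> R) :
  0 < r -> (forall h, `|h| < r -> primitive01 (F h) (f h)) -> primitive01 N m ->
  (forall t : R, 0 <= t <= 1 -> wiener r (m t) (f ^~ t)) ->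
  wiener r (N 1 - N 0) (fun h => F h 1 - F h 0).
Proof.
move=> r0 Ff Nm fm.
apply: (@wiener_lim _ r _ (fun n => \sum_(i < n.+1) m (i%:R / n.+1%:R) / n.+1%:R)
  _ (fun n h => \sum_(i < n.+1) f h (i%:R / n.+1%:R) / n.+1%:R)) => //.
- move=> n; apply: wiener_sum => // i.
  have : 0 <= (i%:R / n.+1%:R : R) <= 1.
    rewrite divr_ge0//= ler_pdivrMr ?ltr0n// mul1r ler_nat.
    exact: (ltnW (ltn_ord i)).
  move=> /fm/(wienerZ (n.+1%:R^-1)); rewrite ger0_norm ?invr_ge0// mulrC.
  by apply: wiener_ext => h _; rewrite mulrC.
- exact: riemann_sum_cvg.
- by move=> h hr; apply: riemann_sum_cvg; exact: Ff.
Qed.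

Lemma is_derive_continuous (R : realType) (f : R -> R) (x d : R) :
  is_derive x 1 f d -> {for x, continuous f}.
Proof.
by move=> df; exact/differentiable_continuous/derivable1_diffP/ex_derive.
Qed.

(** [ln (1 + f)] is the integral of [f / (1 + t * f)] over [0 <= t <= 1]. *)
Lemma wiener_ln1D (R : realType) (r s : R) (f : R -> R) : 0 < r -> s < 1 ->
  wiener r s f -> wiener r (s / (1 - s)) (fun h => ln (1 + f h)).
Proof.
move=> r0 s1 fs; have s0 := wiener_ge0 fs.
have f1 h t : `|h| < r -> 0 <= t <= 1 -> 0 < 1 + t * f h.
  move=> hr /andP[t0 t1].
  have : `|t * f h| < 1.
    rewrite normrM ger0_norm//; apply: le_lt_trans s1.
    rewrite -[leRHS]mul1r; apply: ler_pM => //; exact: wiener_bound hr.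
  by rewrite ltr_norml -subr_gt0 opprK addrC => /andP[].
have -> : s / (1 - s) = s / (1 - s) * 1 - s / (1 - s) * 0 by rewrite mulr1 mulr0 subr0.
apply: (@wiener_ext _ _ _ (fun h => ln (1 + 1 * f h) - ln (1 + 0 * f h))).
  by move=> h _; rewrite mul0r addr0 ln1 subr0 mul1r.
apply: (@wiener_int _ r (fun h t => ln (1 + t * f h))
  (fun h t => f h * (1 + t * f h)^-1) (fun t => s / (1 - s) * t)
  (fun=> s / (1 - s))) => //.
- move=> h hr t t01; have f10 := f1 h t hr t01.
  have dl : is_derive t 1 (fun t => 1 + t * f h) (f h).
    by apply: is_derive_eq; rewrite /GRing.scale/=; ring.
  split.
    have := is_derive1_comp (g := fun t => 1 + t * f h) (is_derive1_ln f10) dl.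
    by rewrite mulrC.
  apply: cvgM; first exact: cvg_cst.
  apply: cvgV; first by rewrite gt_eqF.
  exact: is_derive_continuous dl.
- move=> t t01; split; last exact: cvg_cst.
  by apply: is_derive_eq; rewrite /GRing.scale/=; ring.
- move=> t /andP[t0 t1]; apply: wienerM => //; apply: wiener_inv1D => //.
  apply: (@wiener_le _ _ (`|t| * s)); last exact: wienerZ.
  by rewrite ger0_norm// ler_piMl.
Qed.

Lemma wiener_powR_exponent (R : realType) (r t : R) : 0 < r -> 0 < t <= 1 ->
  wiener r (t `^ (- r)) (fun h => t `^ h).
Proof.
move=> r0 /andP[t0 t1].
have -> : t `^ (- r) = expR (`|ln t| * r).
  by rewrite /powR gt_eqF// ler0_norm ?ln_le0// !mulNr mulrC.
have := wiener_exp r0 (wienerZ (ln t) (wiener_id r0)).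
by apply: wiener_ext => h _; rewrite /powR gt_eqF// mulrC.
Qed.

(** * Integrals on open intervals as primitives *)

(** On each segment of the exhaustion the integral of [g] is at most the increment of
    [H], hence at most [C + C]; monotone convergence does the rest. *)
Lemma integrable_dominated (R : realType) (I : set R) (a b : R^nat)
    (g k H : R -> R) (C : R) :
  open I -> I = \bigcup_n `[a n, b n]%classic ->
  nonincreasing_seq a -> nondecreasing_seq b -> (forall n, a n < b n) ->
  (forall x, I x -> {for x, continuous g}) ->
  (forall x, I x -> {for x, continuous k}) ->
  (forall x, I x -> is_derive x 1 H (k x)) ->
  (forall x, I x -> 0 <= g x <= k x) ->
  (forall x, I x -> `|H x| <= C) ->
  (@lebesgue_measure R).-integrable I (EFin \o g).
Proof.
move=> oI IE da db ab cg ck dH gk HC.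
have sI n : `[a n, b n] `<=` I by rewrite IE => x abx; exists n.
have mg : measurable_fun I g.
  by apply: open_continuous_measurable_fun => // x; rewrite inE; exact: cg.
have mI : measurable I by exact: open_measurable.
apply/integrableP; split; first exact/measurable_EFinP.
under eq_integral => x.
  by rewrite inE => /gk/andP[g0 _]; rewrite /= ger0_norm//; over.
apply: (@le_lt_trans _ _ (C + C)%:E); last exact: ltry.
have : (\int[@lebesgue_measure R]_(x in `[a n, b n]) (g x)%:E)%E @[n --> \oo] -->
    (\int[@lebesgue_measure R]_(x in I) (g x)%:E)%E.
  rewrite IE; apply: ge0_nondecreasing_set_cvg_integral => //.
  - move=> m n mn; apply/subsetPset; apply: subset_itv; rewrite bnd_simp.
      exact: da.
    exact: db.
  - move=> i; apply/measurable_EFinP; exact: measurable_funS mg.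
  - by move=> i x /sI/gk/andP[g0 _]; rewrite lee_fin.
move=> /cvge_to_le; apply; apply: nearW => n.
have mk : measurable_fun I k.
  by apply: open_continuous_measurable_fun => // x; rewrite inE; exact: ck.
have aI : I (a n) by apply: (sI n); rewrite /= in_itv/= lexx ltW.
have bI : I (b n) by apply: (sI n); rewrite /= in_itv/= lexx ltW.
have cH x : I x -> {for x, continuous H}.
  by move=> /dH; exact: is_derive_continuous.
apply: (@le_trans _ _ (\int[@lebesgue_measure R]_(x in `[a n, b n]) (k x)%:E)%E).
  apply: ge0_le_integral => //.
  - by move=> x /sI/gk/andP[g0 _]; rewrite lee_fin.
  - by apply/measurable_EFinP; exact: measurable_funS mg.
  - by apply/measurable_EFinP; exact: measurable_funS mk.
  - by move=> x /sI/gk/andP[_]; rewrite lee_fin.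
rewrite (@continuous_FTC2 _ k H)//.
- rewrite -EFinB lee_fin lerD//.
    exact: le_trans (ler_norm _) (HC _ bI).
  by rewrite (le_trans (ler_norm _))// normrN; exact: HC.
- apply: continuous_in_subspaceT => x; rewrite inE => /sI; exact: ck.
- split.
  + by move=> x /subset_itv_oo_cc/sI/dH d; exact: ex_derive.
  + by apply: cvg_at_right_filter; exact: cH.
  + by apply: cvg_at_left_filter; exact: cH.
- move=> x /subset_itv_oo_cc/sI/dH d; rewrite derive1E; exact: derive_val.
Qed.

Lemma integrable_itv_cc (R : realType) (a b : R) (g : R -> R) :
  (@lebesgue_measure R).-integrable `]a, b[ (EFin \o g) ->
  (@lebesgue_measure R).-integrable `[a, b] (EFin \o g).
Proof.
move=> /integrableP[mg ig]; apply/integrableP; split.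
  apply/emeasurable_fun_itv_obnd_cbndP/emeasurable_fun_itv_bndo_bndcP.
  exact: mg.
by rewrite integral_itv_bndoo//; exact: measurableT_comp.
Qed.

Lemma Rintegral_itv_oo_cc (R : realType) (a b : R) (g : R -> R) :
  (@lebesgue_measure R).-integrable `]a, b[ (EFin \o g) ->
  \int[@lebesgue_measure R]_(t in `[a, b]) g t =
  \int[@lebesgue_measure R]_(t in `]a, b[) g t.
Proof.
by move=> /integrableP[mg _]; rewrite /Rintegral integral_itv_bndoo.
Qed.

Lemma integral_derive (R : realType) (x u : R) (g : R -> R) : 0 < x < u ->
  (@lebesgue_measure R).-integrable `]0, u[ (EFin \o g) ->
  {for x, continuous g} ->
  is_derive x 1 (fun x => \int[@lebesgue_measure R]_(t in `]0, x[) g t) (g x).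
Proof.
move=> /andP[x0 xu] ig cg.
have [] := @continuous_FTC1_closed _ g 0 x u xu (integrable_itv_cc ig) x0 cg.
move=> d1 d2; have d : is_derive x 1
    (fun x => \int[@lebesgue_measure R]_(t in `[0, x]) g t) (g x).
  by apply: (DeriveDef d1); rewrite -[LHS]derive1E.
apply: near_eq_is_derive d; near=> y.
have yu : y < u by near: y; exact: lt_nbhsl.
rewrite Rintegral_itv_oo_cc//.
by apply: integrableS ig => //; apply: subset_itvl; rewrite bnd_simp ltW.
Unshelve. all: by end_near. Qed.

Lemma integral_cvg0 (R : realType) (u : R) (g : R -> R) : 0 < u ->
  (@lebesgue_measure R).-integrable `]0, u[ (EFin \o g) ->
  \int[@lebesgue_measure R]_(t in `]0, x[) g t @[x --> 0^'+] --> 0.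
Proof.
move=> u0 ig.
have := cvg_at_right_filter (parameterized_integral_cvg_left u0 (integrable_itv_cc ig)).
apply: cvg_trans; apply: near_eq_cvg; near=> y.
rewrite /parameterized_integral Rintegral_itv_oo_cc//.
have yu : y < u by near: y; exact: nbhs_right_lt.
by apply: integrableS ig => //; apply: subset_itvl; rewrite bnd_simp ltW.
Unshelve. all: by end_near. Qed.

Lemma integral_cvg_left (R : realType) (u : R) (g : R -> R) : 0 < u ->
  (@lebesgue_measure R).-integrable `]0, u[ (EFin \o g) ->
  \int[@lebesgue_measure R]_(t in `]0, x[) g t @[x --> u^'-] -->
  \int[@lebesgue_measure R]_(t in `]0, u[) g t.
Proof.
move=> u0 ig.
have := parameterized_integral_cvg_at_left u0 (integrable_itv_cc ig).
rewrite {2}/parameterized_integral Rintegral_itv_oo_cc//.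
apply: cvg_trans; apply: near_eq_cvg; near=> y.
rewrite /parameterized_integral Rintegral_itv_oo_cc//.
have yu : y < u by near: y; exact: nbhs_left_lt.
by apply: integrableS ig => //; apply: subset_itvl; rewrite bnd_simp ltW.
Unshelve. all: by end_near. Qed.

(** The integral is nondecreasing in [x], so convergence along the integers, given by
    monotone convergence of sets, is enough. *)
Lemma integral_cvgy (R : realType) (g : R -> R) :
  (forall x, 0 < x -> 0 <= g x) ->
  (@lebesgue_measure R).-integrable `]0, +oo[ (EFin \o g) ->
  \int[@lebesgue_measure R]_(t in `]0, x[) g t @[x --> +oo] -->
  \int[@lebesgue_measure R]_(t in `]0, +oo[) g t.
Proof.
move=> g0 ig.
have mg := measurable_int _ ig.
have Soo (x : R) : `]0, x[ `<=` `]0, +oo[ by exact: subset_itvl.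
have mgx (x : R) : measurable_fun `]0, x[ (EFin \o g) by apply: measurable_funS mg.
have fin (x : R) : (\int[@lebesgue_measure R]_(t in `]0%R, x[) (g t)%:E)%E \is a fin_num.
  by apply: integrable_fin_num => //; exact: integrableS ig.
have finy : (\int[@lebesgue_measure R]_(t in `]0%R, +oo[) (g t)%:E)%E \is a fin_num.
  exact: integrable_fin_num.
have g0' (x : R) : `]0, +oo[%classic x -> (0 <= (EFin \o g) x)%E.
  by rewrite /= in_itv/= andbT lee_fin => /g0.
have cn : (\int[@lebesgue_measure R]_(t in `]0%R, n%:R[) (g t)%:E)%E @[n --> \oo] -->
    (\int[@lebesgue_measure R]_(t in `]0%R, +oo[) (g t)%:E)%E.
  have -> : `]0, +oo[%classic = \bigcup_n `]0, (n%:R : R)[%classic.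
    rewrite (real_interval.itv_bndy_bigcup_BLeft_shift false 0 0).
    by apply: eq_bigcupr => i _; rewrite add0r addn0.
  apply: ge0_nondecreasing_set_cvg_integral => //.
  - move=> m n mn; apply/subsetPset; apply: subset_itvl.
    by rewrite bnd_simp ler_nat.
  - by move=> i; exact: mgx.
  - by move=> i x ix; apply: g0'; exact: Soo ix.
have {}cn : \int[@lebesgue_measure R]_(t in `]0, n%:R[) g t @[n --> \oo] -->
    \int[@lebesgue_measure R]_(t in `]0, +oo[) g t.
  by apply: fine_cvg; rewrite fineK.
have le_int (x y : R) : x <= y ->
    \int[@lebesgue_measure R]_(t in `]0, x[) g t <= \int[@lebesgue_measure R]_(t in `]0, y[) g t.
  move=> xy; apply: fine_le => //; apply: ge0_subset_integral => //.
  - exact: mgx.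
  - by move=> z zy; apply: g0'; exact: Soo zy.
  - by apply: subset_itvl; rewrite bnd_simp.
have le_inty (x : R) :
    \int[@lebesgue_measure R]_(t in `]0, x[) g t <= \int[@lebesgue_measure R]_(t in `]0, +oo[) g t.
  apply: fine_le => //; apply: ge0_subset_integral => //.
apply/cvgrPdist_le => e e0.
have /cvgrPdist_le/(_ e e0)[N _ /(_ N (leqnn _)) /= HN] := cn.
near=> x; rewrite ger0_norm ?subr_ge0//.
apply: le_trans HN; rewrite ger0_norm ?subr_ge0// lerD2l lerN2; apply: le_int.
by near: x; exact: nbhs_pinfty_ge.
Unshelve. all: by end_near. Qed.

(** * Incomplete beta and gamma integrals *)

Lemma is_derive_powR_onem (R : realType) (b t : R) : t < 1 ->
  is_derive t 1 (fun t => (1 - t) `^ b) (- (b * (1 - t) `^ (b - 1))).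
Proof.
move=> t1; have t0 : 0 < 1 - t by rewrite subr_gt0.
have d1 : is_derive t 1 (fun t : R => 1 - t) (-1).
  apply: (is_derive_eq (is_deriveB (is_derive_cst (1 : R) t 1) (is_derive_id t 1))).
  by rewrite sub0r.
have := is_derive1_comp (g := fun t => 1 - t) (is_derive1_powR b t0) d1.
by rewrite mulrN1.
Qed.

Lemma powR_le_half (R : realType) (z c : R) : 2^-1 <= z <= 1 ->
  z `^ c <= 2 `^ `|c|.
Proof.
move=> /andP[z2 z1]; have z0 : 0 < z by exact: lt_le_trans z2.
rewrite /powR gt_eqF// gt_eqF// ler_expR.
have lz : `|ln z| <= ln 2.
  rewrite ler0_norm ?ln_le0// -lnV ?posrE// ler_ln ?posrE ?invr_gt0//.
  by rewrite invf_ple ?posrE// invrK.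
rewrite (le_trans (ler_norm _))// normrM ler_wpM2l//.
Qed.

Lemma itv01_bigcup (R : realType) :
  `]0, 1[%classic = \bigcup_n `[n.+3%:R^-1, 1 - n.+3%:R^-1]%classic :> set R.
Proof.
apply/seteqP; split=> [x /=|x [n _] /=].
  rewrite in_itv/= => /andP[x0 x1].
  have [N1 _ H1] := near_infty_natSinv_lt (PosNum x0).
  have x10 : 0 < 1 - x by rewrite subr_gt0.
  have [N2 _ H2] := near_infty_natSinv_lt (PosNum x10).
  exists (maxn N1 N2) => //=; rewrite in_itv/=.
  have le3 : (maxn N1 N2).+3%:R^-1 <= (maxn N1 N2).+1%:R^-1 :> R.
    by rewrite lef_pV2 ?posrE// ler_nat ltnS leqW// leqW.
  rewrite (le_trans le3) ?(ltW (H1 _ _))//= ?leq_maxl//.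
  by rewrite lerBrDr -lerBrDl (le_trans le3) ?(ltW (H2 _ _))//= leq_maxr.
rewrite !in_itv/= => /andP[nx xn].
have n0 : 0 < n.+3%:R^-1 :> R by rewrite invr_gt0.
by rewrite (lt_le_trans n0 nx) (le_lt_trans xn)// gtrBl.
Qed.

Lemma itv0y_bigcup (R : realType) :
  `]0, +oo[%classic = \bigcup_n `[n.+2%:R^-1, n.+2%:R]%classic :> set R.
Proof.
apply/seteqP; split=> [x /=|x [n _] /=].
  rewrite in_itv/= andbT => x0.
  have [N1 _ H1] := near_infty_natSinv_lt (PosNum x0).
  pose N2 := Num.truncn x.
  exists (maxn N1 N2) => //=; rewrite in_itv/=.
  have le3 : (maxn N1 N2).+2%:R^-1 <= (maxn N1 N2).+1%:R^-1 :> R.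
    by rewrite lef_pV2 ?posrE// ler_nat.
  rewrite (le_trans le3) ?(ltW (H1 _ _))//= ?leq_maxl//.
  rewrite (le_trans (ltW (truncnS_gt x)))// ler_nat.
  by rewrite ltnS leqW// leq_maxr.
rewrite !in_itv/= => /andP[nx _].
by rewrite andbT; apply: lt_le_trans nx; rewrite invr_gt0.
Qed.

Definition beta_density (R : realType) (b a t : R) : R :=
  t `^ (a - 1) * (1 - t) `^ (b - 1).

Lemma beta_density_gt0 (R : realType) (b a t : R) : 0 < t < 1 ->
  0 < beta_density b a t.
Proof.
by move=> /andP[t0 t1]; rewrite mulr_gt0 ?powR_gt0// subr_gt0.
Qed.

Lemma powR_continuous (R : realType) (c x : R) : 0 < x ->
  {for x, continuous (fun x : R => x `^ c)}.
Proof. by move=> x0; exact: is_derive_continuous (is_derive1_powR c x0). Qed.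

Lemma powR_onem_continuous (R : realType) (c x : R) : x < 1 ->
  {for x, continuous (fun x : R => (1 - x) `^ c)}.
Proof. by move=> x0; exact: is_derive_continuous (is_derive_powR_onem c x0). Qed.

Lemma beta_density_continuous (R : realType) (b a t : R) : 0 < t < 1 ->
  {for t, continuous (beta_density b a)}.
Proof.
move=> /andP[t0 t1]; apply: cvgM; first exact: powR_continuous.
exact: powR_onem_continuous.
Qed.

(** On either half of the interval one of the two factors is bounded, and the other
    has an explicit bounded primitive. *)
Lemma beta_density_integrable (R : realType) (b a : R) : 0 < a -> 0 < b ->
  (@lebesgue_measure R).-integrable `]0, 1[ (EFin \o beta_density b a).
Proof.
move=> a0 b0.
(* [c1] bounds the factor in [1 - t] on [t <= 1/2], and [c2] the one in [t] beyond. *)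
pose c1 : R := 2 `^ `|b - 1|; pose c2 : R := 2 `^ `|a - 1|.
have c10 : 0 < c1 by rewrite powR_gt0.
have c20 : 0 < c2 by rewrite powR_gt0.
apply: (@integrable_dominated _ _ (fun n => n.+3%:R^-1) (fun n => 1 - n.+3%:R^-1)
  _ (fun t => c1 * t `^ (a - 1) + c2 * (1 - t) `^ (b - 1))
  (fun t => c1 / a * t `^ a - c2 / b * (1 - t) `^ b) (c1 / a + c2 / b)).
- exact: itv_open.
- exact: itv01_bigcup.
- by move=> m n mn /=; rewrite lef_pV2 ?posrE// ler_nat.
- by move=> m n mn /=; rewrite lerD2l lerN2 lef_pV2 ?posrE// ler_nat.
- move=> n; rewrite ltrBrDr -mulr2n -[_ *+ 2]mulr_natr ltr_pdivrMl// mulr1.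
  by rewrite ltr_nat.
- by move=> x; rewrite /= in_itv/=; exact: beta_density_continuous.
- move=> x /=; rewrite in_itv/= => /andP[x0 x1]; apply: cvgD; apply: cvgMr.
    exact: powR_continuous.
  exact: powR_onem_continuous.
- move=> x /=; rewrite in_itv/= => /andP[x0 x1].
  have d1 := is_derive1_powR a x0; have d2 := is_derive_powR_onem b x1.
  have d3 := is_deriveB (is_deriveZ (c1 / a) d1) (is_deriveZ (c2 / b) d2).
  apply: (is_derive_eq d3); rewrite /GRing.scale/=.
  by field; rewrite ?gt_eqF.
- move=> x /=; rewrite in_itv/= => /[dup] x01 /andP[x0 x1].
  rewrite (ltW (beta_density_gt0 _ _ _))//=.
  have x10 : 0 < 1 - x by rewrite subr_gt0.
  have [x2|x2] := leP x 2^-1.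
    apply: (@le_trans _ _ (c1 * x `^ (a - 1))).
      rewrite /beta_density mulrC ler_wpM2r ?powR_ge0// powR_le_half//.
      by apply/andP; split; lra.
    by rewrite lerDl mulr_ge0 ?powR_ge0 ?(ltW c20).
  apply: (@le_trans _ _ (c2 * (1 - x) `^ (b - 1))).
    by rewrite /beta_density ler_wpM2r ?powR_ge0// powR_le_half// !ltW.
  by rewrite lerDr mulr_ge0 ?powR_ge0 ?(ltW c10).
- move=> x /=; rewrite in_itv/= => /andP[x0 x1].
  have x10 : 0 < 1 - x by rewrite subr_gt0.
  have le1 (y c : R) : 0 < c -> 0 < y -> y <= 1 -> y `^ c <= 1.
    move=> c0 y0 y1; have -> : 1 = 1 `^ c :> R by rewrite powR1.
    by apply: ge0_ler_powR; rewrite ?nnegrE ?(ltW c0) ?(ltW y0).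
  rewrite (le_trans (ler_normB _ _))// lerD// normrM !ger0_norm ?powR_ge0//.
  + by rewrite ler_piMr ?le1 ?ltW// divr_gt0.
  + by rewrite divr_ge0 ?ltW.
  + rewrite ler_piMr ?le1 ?ltW ?divr_gt0//.
    by rewrite gtrBl.
  + by rewrite divr_ge0 ?ltW.
Qed.

Definition ibeta (R : realType) (b a x : R) : R :=
  \int[@lebesgue_measure R]_(t in `]0, x[) beta_density b a t.

Lemma ibeta_fineK (R : realType) (b a x : R) : 0 < a -> 0 < b -> x <= 1 ->
  incomplete_beta a b x = (ibeta b a x)%:E.
Proof.
move=> a0 b0 x1; rewrite /ibeta /Rintegral fineK//.
apply: integrable_fin_num => //; apply: integrableS (beta_density_integrable a0 b0) => //.
by apply: subset_itvl; rewrite bnd_simp.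
Qed.

Lemma ibeta_derive (R : realType) (b a x : R) : 0 < a -> 0 < b -> 0 < x < 1 ->
  is_derive x 1 (ibeta b a) (beta_density b a x).
Proof.
move=> a0 b0 x01; apply: (integral_derive x01).
  exact: beta_density_integrable.
exact: beta_density_continuous.
Qed.

Lemma ibeta_cvg0 (R : realType) (b a : R) : 0 < a -> 0 < b ->
  ibeta b a x @[x --> 0^'+] --> 0.
Proof.
by move=> a0 b0; apply: (integral_cvg0 ltr01); exact: beta_density_integrable.
Qed.

Lemma ibeta_cvg1 (R : realType) (b a : R) : 0 < a -> 0 < b ->
  ibeta b a x @[x --> 1^'-] --> ibeta b a 1.
Proof.
by move=> a0 b0; apply: (integral_cvg_left ltr01); exact: beta_density_integrable.
Qed.

Definition gamma_density (R : realType) (b s : R) : R :=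
  expR (- s) * s `^ (b - 1).

Lemma gamma_density_gt0 (R : realType) (b s : R) : 0 < s -> 0 < gamma_density b s.
Proof. by move=> s0; rewrite mulr_gt0 ?powR_gt0 ?expR_gt0. Qed.

Lemma gamma_density_continuous (R : realType) (b s : R) : 0 < s ->
  {for s, continuous (gamma_density b)}.
Proof.
move=> s0; apply: cvgM; last exact: powR_continuous.
apply: continuous_comp; last exact: continuous_expR.
exact: opp_continuous.
Qed.

(** The tangent line to [ln] at [m]. *)
Lemma ln1D_sublinear (R : realType) (m s : R) : 0 < m -> 0 < s ->
  m * ln (1 + s) <= m * ln m + 1 - m + s.
Proof.
move=> m0 s0; have s10 : 0 < 1 + s by rewrite addr_gt0.
have : ln ((1 + s) / m) <= (1 + s) / m - 1.
  have := @le_ln1Dx _ ((1 + s) / m - 1); rewrite [1 + (_ - 1)]addrC subrK; apply.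
  by rewrite ltrDr divr_gt0.
rewrite ln_div ?posrE// -(ler_pM2l m0) mulrBr mulrBr mulr1 mulrCA divff ?gt_eqF//.
by rewrite mulr1 => h; lra.
Qed.

(** The dominating primitive is a multiple of [(s / (1 + s)) `^ b], written through [ln];
    domination reduces to [expR (- s)] being at most a constant times
    [(1 + s) `^ (- (b + 1))], which is [ln1D_sublinear]. *)
Lemma gamma_density_integrable (R : realType) (b : R) : 0 < b ->
  (@lebesgue_measure R).-integrable `]0, +oo[ (EFin \o gamma_density b).
Proof.
move=> b0; have b10 : 0 < b + 1 by rewrite addr_gt0.
(* The maximum over [s] of [(1 + s) `^ (b + 1) * expR (- s)]. *)
pose K : R := expR ((b + 1) * ln (b + 1) + 1 - (b + 1)).
have K0 : 0 < K by exact: expR_gt0.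
apply: (@integrable_dominated _ _ (fun n => n.+2%:R^-1) (fun n => n.+2%:R)
  _ (fun s => K * (expR (b * (ln s - ln (1 + s))) * (s^-1 - (1 + s)^-1)))
  (fun s => K / b * expR (b * (ln s - ln (1 + s)))) (K / b)).
- exact: interval_open.
- exact: itv0y_bigcup.
- by move=> m n mn /=; rewrite lef_pV2 ?posrE// ler_nat.
- by move=> m n mn /=; rewrite ler_nat.
- move=> n; rewrite invf_plt ?posrE//; apply: (@lt_trans _ _ 1).
    by rewrite invf_lt1// ltr1n.
  by rewrite ltr1n.
- by move=> x; rewrite /= in_itv/= andbT; exact: gamma_density_continuous.
- move=> x /=; rewrite in_itv/= andbT => x0; apply: cvgMr.
  have x10 : 0 < 1 + x by rewrite addr_gt0.
  have c1 : {for x, continuous (fun x : R => 1 + x)}.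
    by apply: cvgD; [exact: cvg_cst|exact: cvg_id].
  apply: cvgM.
    apply: continuous_comp; last exact: continuous_expR.
    apply: cvgMr; apply: cvgB; first exact: continuous_ln.
    by apply: (continuous_comp c1); exact: continuous_ln.
  apply: cvgB.
    by apply: cvgV; [rewrite gt_eqF|exact: cvg_id].
  by apply: cvgV; [rewrite gt_eqF|exact: c1].
- move=> x /=; rewrite in_itv/= andbT => x0.
  have x10 : 0 < 1 + x by rewrite addr_gt0.
  have d1 : is_derive x 1 (fun x : R => 1 + x) 1.
    apply: (is_derive_eq (is_deriveD (is_derive_cst (1 : R) x 1) (is_derive_id x 1))).
    by rewrite add0r.
  have d2 := is_derive1_comp (g := fun x => 1 + x) (is_derive1_ln x10) d1.
  have d3 := is_deriveZ b (is_deriveB (is_derive1_ln x0) d2).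
  have d4 := is_derive1_comp (is_derive_expR _) d3.
  apply: (is_derive_eq (is_deriveZ (K / b) d4)); rewrite /GRing.scale/=.
  by rewrite mulr1 /comp/=; field; rewrite ?gt_eqF.
- move=> x /=; rewrite in_itv/= andbT => x0.
  have x10 : 0 < 1 + x by rewrite addr_gt0.
  rewrite (ltW (gamma_density_gt0 _ _))//=.
  have -> : x^-1 - (1 + x)^-1 = expR (- ln x - ln (1 + x)).
    rewrite expRB expRN !lnK ?posrE//.
    by field; rewrite !gt_eqF.
  rewrite /gamma_density /powR gt_eqF// -!expRD ler_expR.
  have := ln1D_sublinear b10 x0.
  by rewrite !mulrDl !mulrBr !mul1r; lra.
- move=> x /=; rewrite in_itv/= andbT => x0.
  have x10 : 0 < 1 + x by rewrite addr_gt0.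
  have Kb0 : 0 <= K / b by rewrite divr_ge0// ltW.
  rewrite ger0_norm ?(mulr_ge0 Kb0) ?expR_ge0//.
  rewrite ler_piMr// expR_le1 pmulr_rle0// subr_le0.
  by rewrite ler_ln ?posrE// lerDr.
Qed.

Definition igamma (R : realType) (b x : R) : R :=
  \int[@lebesgue_measure R]_(s in `]0, x[) gamma_density b s.

Lemma igamma_derive (R : realType) (b x : R) : 0 < b -> 0 < x ->
  is_derive x 1 (igamma b) (gamma_density b x).
Proof.
move=> b0 x0; apply: (@integral_derive _ x (x + 1)).
- by rewrite x0/= ltrDl.
- by apply: integrableS (gamma_density_integrable b0) => //; exact: subset_itvl.
- exact: gamma_density_continuous.
Qed.

Lemma igamma_cvg0 (R : realType) (b : R) : 0 < b ->
  igamma b x @[x --> 0^'+] --> 0.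
Proof.
move=> b0; apply: (integral_cvg0 ltr01).
by apply: integrableS (gamma_density_integrable b0) => //; exact: subset_itvl.
Qed.

Lemma igamma_cvgy (R : realType) (b : R) : 0 < b ->
  igamma b x @[x --> +oo] --> gamma_fun b.
Proof.
move=> b0; apply: integral_cvgy; last exact: gamma_density_integrable.
by move=> x /(gamma_density_gt0 b)/ltW.
Qed.

(** * Monotonicity from the sign of the derivative *)

Lemma mean_value (R : realType) (f df : R -> R) (x y : R) : x <= y ->
  (forall z, x <= z <= y -> is_derive z 1 f (df z)) ->
  exists2 z, x <= z <= y & f y - f x = df z * (y - x).
Proof.
move=> xy dfP; have [||z] := @MVT_segment _ f df x y xy.
- move=> z; rewrite in_itv/= => /andP[xz zy]; apply: dfP.
  by rewrite !ltW.
- apply: derivable_within_continuous => z; rewrite in_itv/= => zxy.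
  exact: (@ex_derive _ _ _ _ _ _ _ (dfP z zxy)).
- by rewrite in_itv/= => zxy ->; exists z.
Qed.

Lemma derive_ge0_le (R : realType) (f df : R -> R) (x y : R) : x <= y ->
  (forall z, x <= z <= y -> is_derive z 1 f (df z)) ->
  (forall z, x <= z <= y -> 0 <= df z) -> f x <= f y.
Proof.
move=> xy /(mean_value xy)[z zxy fE] df0.
by rewrite -subr_ge0 fE mulr_ge0 ?df0// subr_ge0.
Qed.

Lemma derive_le0_ge (R : realType) (f df : R -> R) (x y : R) : x <= y ->
  (forall z, x <= z <= y -> is_derive z 1 f (df z)) ->
  (forall z, x <= z <= y -> df z <= 0) -> f y <= f x.
Proof.
move=> xy /(mean_value xy)[z zxy fE] df0.
by rewrite -subr_le0 fE mulr_le0_ge0 ?df0// subr_ge0.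
Qed.

Lemma derive_gt0_lt (R : realType) (f df : R -> R) (x y : R) : x < y ->
  (forall z, x <= z <= y -> is_derive z 1 f (df z)) ->
  (forall z, x <= z <= y -> 0 < df z) -> f x < f y.
Proof.
move=> xy /(mean_value (ltW xy))[z zxy fE] df0.
by rewrite -subr_gt0 fE mulr_gt0 ?df0// subr_gt0.
Qed.

(** * Analyticity of the beta integral in its parameter *)

(** In [h] the integrand is a nonnegative constant times [t `^ h], whose norm is
    [t `^ (- r)]: the norm of the integrand at [a] is the integrand at [a - r]. *)
Lemma ibeta_segment_wiener (R : realType) (b a r u v : R) : 0 < b -> 0 < r < a ->
  0 < u <= v -> v < 1 ->
  wiener r (ibeta b (a - r) v - ibeta b (a - r) u)
    (fun h => ibeta b (a + h) v - ibeta b (a + h) u).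
Proof.
move=> b0 /andP[r0 ra] /andP[u0 uv] v1.
have a0 : 0 < a by exact: lt_trans ra.
have ar0 : 0 < a - r by rewrite subr_gt0.
pose g t := u + t * (v - u).
have g01 t : 0 <= t <= 1 -> 0 < g t < 1.
  move=> /andP[t0 t1]; rewrite /g; apply/andP; split.
    by rewrite (lt_le_trans u0)// lerDl mulr_ge0// subr_ge0.
  rewrite (le_lt_trans _ v1)// -lerBrDl ler_piMl// subr_ge0//.
have dg (t : R) : is_derive t 1 g (v - u).
  by apply: is_derive_eq; rewrite /GRing.scale/=; ring.
have cg (t : R) : {for t, continuous g} by exact: is_derive_continuous (dg t).
have prim (a' : R) : 0 < a' -> primitive01 (fun t => ibeta b a' (g t))
    (fun t => beta_density b a' (g t) * (v - u)).
  move=> a'0 t t01; split.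
    exact: is_derive1_comp (ibeta_derive a'0 b0 (g01 t t01)) (dg t).
  apply: cvgM; last exact: cvg_cst.
  by apply: continuous_comp; [exact: cg|exact: beta_density_continuous (g01 t t01)].
have := @wiener_int _ r (fun h t => ibeta b (a + h) (g t))
  (fun h t => beta_density b (a + h) (g t) * (v - u))
  (fun t => ibeta b (a - r) (g t))
  (fun t => beta_density b (a - r) (g t) * (v - u)) r0.
rewrite /g !mul1r !mul0r !addr0 subrKC.
apply.
- move=> h; rewrite ltr_norml => /andP[rh _]; apply: prim.
  by rewrite -ltrBlDl sub0r (lt_trans _ rh)// ltrN2.
- exact: prim.
- move=> t t01; rewrite -/(g t); have /andP[gt0 gt1] := g01 t t01.
  pose c := beta_density b a (g t) * (v - u).
  have c0 : 0 <= c.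
    by rewrite mulr_ge0 ?subr_ge0// ltW// beta_density_gt0// gt0 gt1.
  have grt : 0 < g t <= 1 by rewrite gt0 ltW.
  have densE h : beta_density b (a + h) (g t) * (v - u) = c * g t `^ h.
    have powE : g t `^ (a + h - 1) = g t `^ (a - 1) * g t `^ h.
      by rewrite -powRD ?(gt_eqF gt0) ?implybT// addrAC.
    rewrite /c /beta_density powE.
    by move: (_ `^ (a - 1)) (_ `^ h) (_ `^ (b - 1)) => A G B; ring.
  have := wienerZ c (wiener_powR_exponent r0 grt).
  rewrite (ger0_norm c0) -densE.
  by apply: wiener_ext => h _; rewrite densE.
Qed.

(** The two end points, where the integrand may be singular, are reached by limits of
    [ibeta_segment_wiener]; the norm bound converges along with the functions. *)
Lemma ibeta_wiener (R : realType) (b a r x : R) : 0 < b -> 0 < r < a ->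
  0 < x <= 1 -> wiener r (ibeta b (a - r) x) (fun h => ibeta b (a + h) x).
Proof.
move=> b0 ra; have /andP[r0 ra'] := ra.
have ar0 : 0 < a - r by rewrite subr_gt0.
have ah0 h : `|h| < r -> 0 < a + h.
  rewrite ltr_norml => /andP[rh _].
  by rewrite -ltrBlDl sub0r (lt_trans _ rh)// ltrN2.
have lt1 (y : R) : 0 < y < 1 -> wiener r (ibeta b (a - r) y) (fun h => ibeta b (a + h) y).
  move=> /andP[y0 y1]; pose u n : R := y / n.+1%:R.
  have u0 n : 0 < u n by rewrite divr_gt0.
  have uy n : u n <= y by rewrite ler_piMr ?(ltW y0)// invf_le1// ler1n.
  have cu : u n @[n --> \oo] --> (0 : R).
    by rewrite -[0](mulr0 y); apply: cvgMr; exact: cvg_harmonic.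
  have ci a' : 0 < a' -> ibeta b a' y - ibeta b a' (u n) @[n --> \oo] --> ibeta b a' y.
    move=> a'0; rewrite -[X in _ --> X]subr0; apply: cvgB; first exact: cvg_cst.
    by have /cvg_at_rightP := ibeta_cvg0 a'0 b0; apply.
  apply: (@wiener_lim _ r _ (fun n => ibeta b (a - r) y - ibeta b (a - r) (u n)) _
    (fun n h => ibeta b (a + h) y - ibeta b (a + h) (u n))) => //.
  - by move=> n; apply: ibeta_segment_wiener; rewrite // u0 uy.
  - exact: ci.
  - by move=> h /ah0; exact: ci.
move=> /andP[x0]; rewrite le_eqVlt => /predU1P[->|x1]; last first.
  by apply: lt1; rewrite x0.
pose v n : R := 1 - n.+2%:R^-1.
have v1 n : v n < 1 by rewrite gtrBl.
have v0 n : 0 < v n by rewrite subr_gt0 invf_lt1// ltr1n.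
have cv : v n @[n --> \oo] --> (1 : R).
  rewrite -[X in _ --> X]subr0; apply: cvgB; first exact: cvg_cst.
  have := @cvg_harmonic R; rewrite -cvg_shiftS.
  by apply: cvg_trans.
have ci a' : 0 < a' -> ibeta b a' (v n) @[n --> \oo] --> ibeta b a' 1.
  by move=> a'0; have /cvg_at_leftP := ibeta_cvg1 a'0 b0; apply.
apply: (@wiener_lim _ r _ (fun n => ibeta b (a - r) (v n)) _
  (fun n h => ibeta b (a + h) (v n))) => //.
- by move=> n; apply: lt1; rewrite v0 v1.
- exact: ci.
- by move=> h /ah0; exact: ci.
Qed.

(** * The Newton iteration and analyticity of the quantile *)

(** The density of the beta integral in the variable [w = - ln t]. *)
Definition log_density (R : realType) (b a w : R) : R :=
  expR (- (a * w)) * (1 - expR (- w)) `^ (b - 1).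

Lemma expRN_lt1 (R : realType) (w : R) : 0 < w -> 0 < expR (- w) < 1.
Proof. by move=> w0; rewrite expR_gt0 expR_lt1 oppr_lt0. Qed.

Lemma log_density_gt0 (R : realType) (b a w : R) : 0 < w -> 0 < log_density b a w.
Proof.
move=> /expRN_lt1/andP[e0 e1].
by rewrite mulr_gt0 ?expR_gt0// powR_gt0// subr_gt0.
Qed.

Lemma is_derive_expRN (R : realType) (c w : R) :
  is_derive w 1 (fun w => expR (- (c * w))) (- c * expR (- (c * w))).
Proof.
have d : is_derive w 1 (fun w => - (c * w)) (- c).
  by apply: is_derive_eq; rewrite /GRing.scale/=; ring.
by have := is_derive1_comp (is_derive_expR _) d; rewrite mulrC.
Qed.

Lemma log_density_continuous (R : realType) (b a w : R) : 0 < w ->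
  {for w, continuous (log_density b a)}.
Proof.
move=> w0; apply: cvgM.
  exact: is_derive_continuous (is_derive_expRN a w).
apply: (@continuous_comp _ _ _ (fun w => expR (- w)) (fun x => (1 - x) `^ (b - 1))).
  by apply: continuous_comp; [exact: opp_continuous|exact: continuous_expR].
by apply: powR_onem_continuous; have /andP[] := expRN_lt1 w0.
Qed.

Lemma ibeta_log_derive (R : realType) (b a w : R) : 0 < b -> 0 < a -> 0 < w ->
  is_derive w 1 (fun w => ibeta b a (expR (- w))) (- log_density b a w).
Proof.
move=> b0 a0 w0.
have d1 : is_derive w 1 (fun w : R => expR (- w)) (- expR (- w)).
  have := is_derive_expRN 1 w; rewrite mul1r mulN1r.
  by under [X in is_derive _ _ X _]funext do rewrite mul1r.
have := is_derive1_comp (g := fun w => expR (- w))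
  (ibeta_derive a0 b0 (expRN_lt1 w0)) d1.
rewrite mulrN /beta_density /log_density mulrAC.
have -> : expR (- w) `^ (a - 1) * expR (- w) = expR (- (a * w)).
  rewrite -expRM -expRD; congr expR; ring.
by [].
Qed.

Lemma ibeta_log_decreasing (R : realType) (b a w w' : R) : 0 < b -> 0 < a ->
  0 < w -> w < w' -> ibeta b a (expR (- w')) < ibeta b a (expR (- w)).
Proof.
move=> b0 a0 w0 ww'.
have := @derive_gt0_lt _ (fun w => - ibeta b a (expR (- w))) (log_density b a) _ _ ww'.
rewrite ltrN2; apply=> z /andP[wz _].
  have := is_deriveN (ibeta_log_derive b0 a0 (lt_le_trans w0 wz)).
  by rewrite opprK.
by apply: log_density_gt0; exact: lt_le_trans wz.
Qed.

(** The quotient is the exponential of a function built from [h] and [k h] that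
    vanishes with them, and whose norm is at most a [delta s] that tends to [0]. *)
Lemma log_density_ratio_wiener (R : realType) (b a0 w0 : R) : 0 < a0 -> 0 < w0 ->
  exists s : R, [/\ 0 < s, s < w0, s < a0 &
    forall (r : R) (k : R -> R), 0 < r <= s -> wiener r s k ->
      wiener r 2^-1
        (fun h => 1 - log_density b (a0 + h) (w0 + k h) / log_density b a0 w0)].
Proof.
move=> a00 w00; have /andP[e0 e1] := expRN_lt1 w00.
have e10 : 0 < 1 - expR (- w0) by rewrite subr_gt0.
pose C := expR (- w0) / (1 - expR (- w0)).
have C0 : 0 < C by rewrite divr_gt0.
(* [eta s] bounds the norm of [y], where [1 + y] is the quotient of the bases of the
   powers [b - 1], and [delta s] that of the exponent [E]. *)
pose eta s := C * (expR s - 1).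
pose delta s := (a0 + s) * s + s * w0 + `|b - 1| * (eta s / (1 - eta s)).
have ceta : eta s @[s --> (0 : R)] --> eta 0.
  apply: cvgMr; apply: cvgB; last exact: cvg_cst.
  exact: continuous_expR.
have eta0 : eta 0 = 0 by rewrite /eta expR0 subrr mulr0.
have cdelta : expR (delta s) - 1 @[s --> (0 : R)] --> expR (delta 0) - 1.
  apply: cvgB; last exact: cvg_cst.
  apply: (@continuous_comp R R R delta expR 0); last exact: continuous_expR.
  apply: cvgD.
    apply: cvgD; last by apply: cvgMl; exact: cvg_id.
    by apply: cvgM; [apply: cvgD; [exact: cvg_cst|exact: cvg_id]|exact: cvg_id].
  apply: cvgMr; apply: cvgM => //; apply: cvgV.
    by rewrite eta0 subr0 oner_neq0.
  by apply: cvgB => //; exact: cvg_cst.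
have delta0 : expR (delta 0) - 1 = 0.
  by rewrite /delta eta0 mulr0 !mul0r mulr0 !addr0 expR0 subrr.
have [s [s0 sw sa es ds]] : exists s, [/\ 0 < s, s < w0, s < a0, eta s < 1 &
    expR (delta s) - 1 <= 2^-1].
  near (0 : R)^'+ => s; exists s; split.
  - by [].
  - by near: s; exact: nbhs_right_lt.
  - by near: s; exact: nbhs_right_lt.
  - near: s; apply: (cvgr_lt (eta 0)); first exact: cvg_at_right_filter ceta.
    by rewrite eta0.
  - near: s; apply: (cvgr_le (expR (delta 0) - 1)).
      exact: cvg_at_right_filter cdelta.
    by rewrite delta0.
exists s; split => // r k /andP[r0 rs] ks.
pose y h := C * (1 - expR (- k h)).
have yw : wiener r (eta s) y.
  have := wienerZ (- C) (wiener_exp_sub1 r0 (wienerN ks)).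
  rewrite normrN (gtr0_norm C0); apply: wiener_ext => h _.
  by rewrite mulNr -mulrN opprB.
have y1 h : `|h| < r -> 0 < 1 + y h.
  move=> hr; have := le_lt_trans (wiener_bound yw hr) es.
  by rewrite ltr_norml -subr_gt0 opprK addrC => /andP[].
pose E h := (b - 1) * ln (1 + y h) - ((a0 + h) * k h + w0 * h).
have Ew : wiener r (delta s) E.
  have eta_ge0 := wiener_ge0 yw.
  apply: (@wiener_le _ _ (`|b - 1| * (eta s / (1 - eta s)) +
      ((`|a0| + r) * s + `|w0| * r))).
    rewrite (gtr0_norm a00) (gtr0_norm w00) [leLHS]addrC /delta lerD2r lerD//.
      by rewrite ler_wpM2r ?(ltW s0)// lerD2l.
    by rewrite mulrC ler_wpM2r// ltW.
  apply: wienerB; first exact: ltW.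
    by apply: wienerZ; exact: wiener_ln1D.
  apply: wienerD; first exact: ltW.
    apply: wienerM => //; apply: wienerD; first exact: ltW.
      exact: wiener_cst.
    exact: wiener_id.
  by apply: wienerZ; exact: wiener_id.
have := wienerN (wiener_exp_sub1 r0 Ew).
move=> /(wiener_le ds); apply: wiener_ext => h hr.
rewrite opprB; congr (1 - _).
rewrite /log_density.
have -> : 1 - expR (- (w0 + k h)) = (1 - expR (- w0)) * (1 + y h).
  rewrite /y /C opprD expRD.
  by field; rewrite gt_eqF.
rewrite powRM ?(ltW e10) ?(ltW (y1 h hr))//.
have -> : expR (E h) = (1 + y h) `^ (b - 1) *
    expR (- ((a0 + h) * (w0 + k h)) + a0 * w0).
  rewrite /powR gt_eqF ?y1// -expRD; congr expR; rewrite /E; ring.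
have p0 : (1 - expR (- w0)) `^ (b - 1) != 0 by rewrite gt_eqF// powR_gt0.
rewrite expRD -[a0 * w0 in LHS]opprK [expR (- - _)]expRN.
have x0 : expR (- (a0 * w0)) != 0 by rewrite gt_eqF// expR_gt0.
by field; rewrite p0 x0.
Unshelve. all: by end_near. Qed.

Lemma contraction_half (R : realType) (T dT : R -> R) (s x y : R) :
  `|x| <= s -> `|y| <= s ->
  (forall z : R, `|z| <= s -> is_derive z 1 T (dT z) /\ `|dT z| <= 2^-1) ->
  `|T x - T y| <= 2^-1 * `|x - y|.
Proof.
move=> + + Tp; wlog yx : x y / y <= x => [H xs ys|].
  have [yx|/ltW xy] := leP y x; first exact: H.
  by rewrite distrC [`|x - y|]distrC; exact: H.
rewrite 2!ler_norml => /andP[_ xs] /andP[ys _].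
have zs z : y <= z <= x -> `|z| <= s.
  by move=> /andP[yz zx]; rewrite ler_norml (le_trans ys yz) (le_trans zx xs).
have [z zyx ->] := mean_value yx (fun z zyx => (Tp z (zs z zyx)).1).
by rewrite normrM ler_wpM2r// (Tp z (zs z zyx)).2.
Qed.

(** The iterates from [0] stay in a ball that is closed under pointwise limits, so a
    contraction of the real line at each [h] makes the fixed point analytic. *)
Lemma wiener_fixpoint (R : realType) (r s : R) (T : R -> R -> R) (x : R -> R) :
  0 < r -> 0 <= s ->
  (forall k, wiener r s k -> wiener r s (fun h => T h (k h))) ->
  (forall h, `|h| < r -> `|x h| <= s) ->
  (forall h y, `|h| < r -> `|y| <= s -> `|T h y - x h| <= 2^-1 * `|y - x h|) ->
  wiener r s x.
Proof.
move=> r0 s0 Ts xs Tx.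
pose k n := iter n (fun k h => T h (k h)) (fun=> 0).
have kw n : wiener r s (k n).
  elim: n => [|n IHn]; last exact: Ts.
  by apply: (wiener_le _ (wiener_cst 0 r0)); rewrite normr0.
apply: (@wiener_lim _ r _ (fun=> s) _ k) => //; first exact: cvg_cst.
move=> h hr.
have kx n : `|k n h - x h| <= s * 2^-1 ^+ n.
  elim: n => [|n IHn]; first by rewrite /k/= sub0r normrN expr0 mulr1 xs.
  rewrite exprS mulrCA.
  apply: le_trans (Tx h (k n h) hr (wiener_bound (kw n) hr)) _.
  by rewrite ler_wpM2l.
apply/cvgrPdist_le => e e0; near=> n.
rewrite distrC; apply: le_trans (kx n) _; near: n.
apply: (cvgr_le 0) => //; rewrite -(mulr0 s); apply: cvgMr; apply: cvg_expr.
by rewrite ger0_norm// invf_lt1// ltr1n.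
Unshelve. all: by end_near. Qed.

(** Simplified Newton step, in the unknown [y = w - w0], for the equation
    [ibeta b a (expR (- w)) = p * ibeta b a 1] at [a = a0 + h]; the slope is frozen
    at [h = y = 0]. *)
Definition newton_map (R : realType) (p b a0 w0 h y : R) : R :=
  y + (log_density b a0 w0)^-1 *
    (ibeta b (a0 + h) (expR (- (w0 + y))) - p * ibeta b (a0 + h) 1).

Lemma newton_map_derive (R : realType) (p b a0 w0 h y : R) : 0 < b ->
  0 < a0 + h -> 0 < w0 + y ->
  is_derive y 1 (newton_map p b a0 w0 h)
    (1 - log_density b (a0 + h) (w0 + y) / log_density b a0 w0).
Proof.
move=> b0 ah0 wy0.
have d1 : is_derive y 1 (fun y : R => w0 + y) 1.
  by apply: is_derive_eq; rewrite /GRing.scale/=; ring.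
have d2 := is_derive1_comp (g := fun y => w0 + y) (ibeta_log_derive b0 ah0 wy0) d1.
have d3 := is_deriveZ (log_density b a0 w0)^-1
  (is_deriveB d2 (is_derive_cst (p * ibeta b (a0 + h) 1) y 1)).
apply: (is_derive_eq (is_deriveD (is_derive_id y 1) d3)).
rewrite /GRing.scale/= mulr1 subr0 mulrN.
by rewrite [_^-1 * _]mulrC.
Qed.

(** Along the segment from [0] to [k h] the derivative of the Newton map has norm at
    most [1 / 2], so its increment has norm at most [s / 2]. *)
Lemma newton_map_wiener (R : realType) (p b a0 w0 r s : R) (k : R -> R) :
  0 < b -> 0 < r ->
  (forall h, `|h| < r -> 0 < a0 + h) -> (forall y, `|y| <= s -> 0 < w0 + y) ->
  (forall k, wiener r s k -> wiener r 2^-1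
    (fun h => 1 - log_density b (a0 + h) (w0 + k h) / log_density b a0 w0)) ->
  wiener r (s / 2) (newton_map p b a0 w0 ^~ 0) ->
  wiener r s k -> wiener r s (fun h => newton_map p b a0 w0 h (k h)).
Proof.
move=> b0 r0 ah0 wy0 half N0 ks; have s0 := wiener_ge0 ks.
pose G h t := newton_map p b a0 w0 h (t * k h).
apply: (@wiener_ext _ _ _ (fun h => (G h 1 - G h 0) + newton_map p b a0 w0 h 0)).
  by move=> h _; rewrite /G mul1r mul0r subrK.
rewrite [s]splitr; apply: wienerD => //; first exact: ltW.
have -> : s / 2 = s / 2 * 1 - s / 2 * 0 by ring.
have tks h t : `|h| < r -> 0 <= t <= 1 -> `|t * k h| <= s.
  move=> hr /andP[t0 t1]; rewrite normrM (ger0_norm t0).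
  by rewrite (le_trans _ (wiener_bound ks hr))// ler_piMl.
apply: (@wiener_int _ r G (fun h t =>
  k h * (1 - log_density b (a0 + h) (w0 + t * k h) / log_density b a0 w0))
  (fun t => s / 2 * t) (fun=> s / 2) r0).
- move=> h hr t t01; have wt0 := wy0 _ (tks h t hr t01).
  have d1 : is_derive t 1 (fun t => t * k h) (k h).
    by apply: is_derive_eq; rewrite /GRing.scale/=; ring.
  split.
    have := is_derive1_comp (g := fun t => t * k h)
      (newton_map_derive p b0 (ah0 h hr) wt0) d1.
    by rewrite mulrC.
  have d2 : {for t, continuous (fun t : R => w0 + t * k h)}.
    by apply: cvgD; [exact: cvg_cst|exact: is_derive_continuous d1].
  have cl : {for t, continuous (fun t : R => log_density b (a0 + h) (w0 + t * k h))}.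
    apply: (@continuous_comp R R R (fun t => w0 + t * k h) (log_density b (a0 + h))).
      exact: d2.
    exact: log_density_continuous.
  apply: cvgMr; apply: cvgB; first exact: cvg_cst.
  exact: cvgMl cl.
- move=> t _; split; last exact: cvg_cst.
  by apply: is_derive_eq; rewrite /GRing.scale/=; ring.
- move=> t /andP[t0 t1]; apply: wienerM => //; apply: (half (fun h => t * k h)).
  apply: (@wiener_le _ _ (`|t| * s)); last exact: wienerZ.
  by rewrite (ger0_norm t0) ler_piMl.
Qed.

(** In the variable [w = - ln q] the quantile is the fixed point of the Newton map.
    That it lies in the ball of radius [s] is read off from the signs of the equation
    at [w0 - s] and [w0 + s], since the incomplete beta integral is monotone. *)
Lemma quantile_analytic (R : realType) (p b : R) (q : R -> R) : 0 < b ->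
  (forall a : R, 0 < a -> 0 < q a < 1) ->
  (forall a : R, 0 < a -> ibeta b a (q a) = p * ibeta b a 1) ->
  real_analytic_on `]0, +oo[ (fun a => - a * ln (q a)).
Proof.
move=> b0 q01 qE a0 /=; rewrite in_itv/= andbT => a00.
pose w a := - ln (q a).
have w_gt0 a : 0 < a -> 0 < w a by move=> /q01 qa; rewrite oppr_gt0 ln_lt0.
have wE a : 0 < a -> ibeta b a (expR (- w a)) = p * ibeta b a 1.
  by move=> /[dup] a_gt0 /q01/andP[q0 _]; rewrite opprK lnK ?posrE// qE.
set w0 := w a0; have w00 : 0 < w0 by exact: w_gt0.
have [s [s0 sw sa half]] := log_density_ratio_wiener b a00 w00.
have id0 : 0 < (log_density b a0 w0)^-1 by rewrite invr_gt0 log_density_gt0.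
have r10 : 0 < a0 / 2 by rewrite divr_gt0.
have r1a : 0 < a0 / 2 < a0 by rewrite r10/= gtr_pMr// invf_lt1// ltr1n.
have [M NM] : exists M, wiener (a0 / 2) M (newton_map p b a0 w0 ^~ 0).
  eexists; apply: (@wiener_ext _ _ _ (fun h => (log_density b a0 w0)^-1 *
      (ibeta b (a0 + h) (expR (- w0)) - p * ibeta b (a0 + h) 1))).
    by move=> h _; rewrite /newton_map add0r addr0.
  apply: wienerZ; apply: wienerB; first exact: ltW.
    apply: ibeta_wiener => //.
    by have /andP[-> /ltW] := expRN_lt1 w00.
  by apply: wienerZ; apply: ibeta_wiener; rewrite // ltr01 lexx.
have N00 : newton_map p b a0 w0 0 0 = 0.
  by rewrite /newton_map !addr0 wE// subrr mulr0 addr0.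
have s20 : 0 < s / 2 by rewrite divr_gt0.
have [r [r0 rs Nr]] := wiener_vanish_small r10 s0 s20 NM N00.
have ah0 h : `|h| < r -> 0 < a0 + h.
  rewrite ltr_norml => /andP[rh _]; rewrite -ltrBlDl sub0r (lt_trans _ rh)// ltrN2.
  exact: le_lt_trans sa.
have wy0 y : `|y| <= s -> 0 < w0 + y.
  rewrite ler_norml => /andP[sy _]; rewrite -ltrBlDl sub0r (lt_le_trans _ sy)//.
  by rewrite ltrN2.
have {}half k : wiener r s k -> wiener r 2^-1
    (fun h => 1 - log_density b (a0 + h) (w0 + k h) / log_density b a0 w0).
  by apply: half; rewrite r0.
have Nw k := @newton_map_wiener _ p b a0 w0 r s k b0 r0 ah0 wy0 half Nr.
have cst_w y : `|y| <= s -> wiener r s (fun=> y).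
  by move=> ys; apply: (wiener_le ys); exact: wiener_cst.
have Nb h y : `|h| < r -> `|y| <= s -> `|newton_map p b a0 w0 h y| <= s.
  by move=> hr ys; exact: (wiener_bound (Nw _ (cst_w _ ys)) hr).
have xs h : `|h| < r -> `|w (a0 + h) - w0| <= s.
  move=> hr; have ah := ah0 h hr.
  have ss : `|s| <= s by rewrite gtr0_norm.
  have sNs : `|- s| <= s by rewrite normrN.
  rewrite ler_norml; apply/andP; split.
    have := Nb _ _ hr sNs; rewrite ler_norml => /andP[+ _].
    rewrite /newton_map lerDl pmulr_rge0// subr_ge0 -wE// => le1.
    rewrite leNgt; apply/negP => xs; move: le1; rewrite leNgt => /negP; apply.
    apply: ibeta_log_decreasing => //; first exact: w_gt0.
    by rewrite -ltrBlDl.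
  have := Nb _ _ hr ss; rewrite ler_norml => /andP[_].
  rewrite /newton_map gerDl pmulr_rle0// subr_le0 -wE// => le1.
  rewrite leNgt; apply/negP => xs; move: le1; rewrite leNgt => /negP; apply.
  apply: ibeta_log_decreasing => //; first exact: wy0.
  by rewrite -ltrBrDl.
have ws : wiener r s (fun h => w (a0 + h) - w0).
  apply: (@wiener_fixpoint _ r s (newton_map p b a0 w0) _ r0 (ltW s0) Nw xs).
  move=> h y hr ys; have ah := ah0 h hr.
  set x := w (a0 + h) - w0.
  have Nx : newton_map p b a0 w0 h x = x.
    by rewrite /newton_map /x subrKC wE// subrr mulr0 addr0.
  rewrite -[x in `|_ - x|]Nx.
  apply: (@contraction_half _ _
    (fun z => 1 - log_density b (a0 + h) (w0 + z) / log_density b a0 w0) s _ _ ys).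
    exact: xs.
  move=> z zs; split; first exact: newton_map_derive (ah0 h hr) (wy0 z zs).
  exact: (wiener_bound (half _ (cst_w _ zs)) hr).
have phiw := wienerM r0 (wienerD (ltW r0) (wiener_cst a0 r0) (wiener_id r0))
  (wienerD (ltW r0) (wiener_cst w0 r0) ws).
apply: (wiener_analytic r0); apply: wiener_ext phiw => h _.
by rewrite subrKC /w mulrN mulNr.
Qed.

(** * Monotonicity of the quantile *)

(** Concavity of [x `^ r], obtained from the convexity of its inverse function
    [u `^ r^-1]. *)
Lemma powR_chord_slope (R : realType) (r x y : R) : 0 < r <= 1 ->
  0 < x -> x <= y -> y < 1 ->
  (1 - y `^ r) / (1 - y) <= (1 - x `^ r) / (1 - x).
Proof.
move=> /andP[r0 r1] x0 xy y1.
have y0 : 0 < y by exact: lt_le_trans xy.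
have x1 : x < 1 by exact: le_lt_trans y1.
have x10 : 0 < 1 - x by rewrite subr_gt0.
have y10 : 0 < 1 - y by rewrite subr_gt0.
rewrite ler_pdivrMr// mulrAC ler_pdivlMr//.
(* [y] is the barycenter of [x] and [1] with weights [th] and [1 - th]. *)
pose th : R := (1 - y) / (1 - x).
have th0 : 0 <= th by rewrite divr_ge0// ltW.
have th1 : th <= 1 by rewrite ler_pdivrMr// mul1r lerD2l lerN2.
have yE : y = th * x + (1 - th) by rewrite /th; field; rewrite gt_eqF.
have xr0 : 0 <= x `^ r by rewrite powR_ge0.
have cvx : (th * x `^ r + (1 - th)) `^ r^-1 <= y.
  have cvx : (th * x `^ r + (1 - th) * 1) `^ r^-1 <=
      th * (x `^ r) `^ r^-1 + (1 - th) * 1 `^ r^-1.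
    apply: (@convex_powR R r^-1 _ (Itv01 th0 th1) (x `^ r) 1).
    - by rewrite invf_ge1.
    - by rewrite inE/= in_itv/= andbT.
    - by rewrite inE/= in_itv/= andbT ler01.
  move: cvx; rewrite mulr1 -powRrM divff ?gt_eqF// powRr1 ?(ltW x0)//.
  by rewrite powR1 mulr1 -yE.
have c0 : 0 <= th * x `^ r + (1 - th).
  by apply: addr_ge0; [exact: mulr_ge0|rewrite subr_ge0].
have : th * x `^ r + (1 - th) <= y `^ r.
  have := @ge0_ler_powR R r (ltW r0) ((th * x `^ r + (1 - th)) `^ r^-1) y.
  rewrite !nnegrE powR_ge0 (ltW y0) => /(_ isT isT cvx).
  by rewrite -powRrM mulVf ?gt_eqF// powRr1.
move=> h; have : (1 - y `^ r) <= th * (1 - x `^ r) by rewrite mulrBr mulr1; lra.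
rewrite /th mulrAC ler_pdivlMr// => /le_trans; apply.
by rewrite mulrC.
Qed.

(** A monotone likelihood ratio orders the laws. With [l] the ratio at [x0], the
    function [G - l * F] increases up to [x0] and decreases after it, so it is at least
    its limits at both ends. *)
Lemma ratio_noninc_le (R : realType) (F G f c : R -> R) (x0 F1 G1 : R) :
  0 < x0 < 1 ->
  (forall x : R, 0 < x < 1 -> is_derive x 1 F (f x)) ->
  (forall x : R, 0 < x < 1 -> is_derive x 1 G (c x * f x)) ->
  (forall x : R, 0 < x < 1 -> 0 <= f x) ->
  (forall x y : R, 0 < x -> x <= y -> y < 1 -> c y <= c x) ->
  F x @[x --> 0^'+] --> 0 -> G x @[x --> 0^'+] --> 0 ->
  F x @[x --> 1^'-] --> F1 -> G x @[x --> 1^'-] --> G1 ->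
  G1 * F x0 <= F1 * G x0.
Proof.
move=> /andP[x00 x01] dF dG f0 cdec F0 G0 cF1 cG1.
pose l := c x0; pose D x := G x - l * F x.
have dD (x : R) : 0 < x < 1 -> is_derive x 1 D ((c x - l) * f x).
  move=> x01'; apply: (is_derive_eq (is_deriveB (dG x x01') (is_deriveZ l (dF x x01')))).
  by rewrite /GRing.scale/=; ring.
have Fmono x y : 0 < x -> x <= y -> y < 1 -> F x <= F y.
  move=> x_gt0 xy y1; apply: (derive_ge0_le xy) => z /andP[xz zy].
    by apply: dF; rewrite (lt_le_trans x_gt0 xz) (le_lt_trans zy y1).
  by apply: f0; rewrite (lt_le_trans x_gt0 xz) (le_lt_trans zy y1).
have Fx0 : 0 <= F x0.
  apply: (cvgr_to_le F0); near=> x; apply: Fmono => //.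
  by near: x; exact: nbhs_right_le.
have FxF1 : F x0 <= F1.
  apply: (cvgr_to_ge cF1); near=> y; apply: Fmono => //.
  by near: y; exact: nbhs_left_ge.
have D0 : 0 <= D x0.
  have cD : D x @[x --> 0^'+] --> 0.
    by rewrite -[X in _ --> X]subr0 -[X in _ - X](mulr0 l); apply: cvgB => //; exact: cvgMr.
  apply: (cvgr_to_le cD); near=> x.
  have xx0 : x <= x0 by near: x; exact: nbhs_right_le.
  have xgt0 : 0 < x by [].
  apply: (derive_ge0_le xx0) => z /andP[xz zx0]; have z0 := lt_le_trans xgt0 xz.
    by apply: dD; rewrite z0 (le_lt_trans zx0).
  rewrite mulr_ge0 ?f0 ?z0 ?(le_lt_trans zx0)// subr_ge0; exact: cdec.
have D1 : G1 - l * F1 <= D x0.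
  have cD : D x @[x --> 1^'-] --> G1 - l * F1 by apply: cvgB => //; exact: cvgMr.
  apply: (cvgr_to_le cD); near=> x.
  have xx0 : x0 <= x by near: x; exact: nbhs_left_ge.
  have xlt1 : x < 1 by [].
  apply: (derive_le0_ge xx0) => z /andP[xz zx].
    by apply: dD; rewrite (lt_le_trans x00 xz) (le_lt_trans zx).
  rewrite mulr_le0_ge0 ?subr_le0 ?cdec ?(le_lt_trans zx)//.
  by rewrite f0// (lt_le_trans x00 xz) (le_lt_trans zx).
apply: (@le_trans _ _ ((G x0 + l * (F1 - F x0)) * F x0)).
  by rewrite ler_wpM2r//; move: D1; rewrite /D; lra.
have : (F1 - F x0) * (l * F x0) <= (F1 - F x0) * G x0.
  by rewrite ler_wpM2l ?subr_ge0//; move: D0; rewrite /D subr_ge0.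
by lra.
Unshelve. all: by end_near. Qed.

Lemma ratio_nondec_ge (R : realType) (F G f c : R -> R) (x0 F1 G1 : R) :
  0 < x0 < 1 ->
  (forall x : R, 0 < x < 1 -> is_derive x 1 F (f x)) ->
  (forall x : R, 0 < x < 1 -> is_derive x 1 G (c x * f x)) ->
  (forall x : R, 0 < x < 1 -> 0 <= f x) ->
  (forall x y : R, 0 < x -> x <= y -> y < 1 -> c x <= c y) ->
  F x @[x --> 0^'+] --> 0 -> G x @[x --> 0^'+] --> 0 ->
  F x @[x --> 1^'-] --> F1 -> G x @[x --> 1^'-] --> G1 ->
  F1 * G x0 <= G1 * F x0.
Proof.
move=> x01 dF dG f0 cinc F0 G0 cF1 cG1.
have := @ratio_noninc_le R F (fun x => - G x) f (fun x => - c x) x0 F1 (- G1) x01 dF.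
rewrite mulNr mulrN lerN2; apply => //.
- by move=> x x01'; rewrite mulNr; exact: is_deriveN (dG x x01').
- by move=> x y x0' xy y1; rewrite lerN2; exact: cinc.
- by rewrite -[X in _ --> X]oppr0; exact: cvgN.
- exact: cvgN.
Qed.

Lemma ibeta_increasing (R : realType) (b a x y : R) : 0 < b -> 0 < a ->
  0 < x -> x < y -> y < 1 -> ibeta b a x < ibeta b a y.
Proof.
move=> b0 a0 x0 xy y1; have z01 z : x <= z <= y -> 0 < z < 1.
  by move=> /andP[xz zy]; rewrite (lt_le_trans x0 xz) (le_lt_trans zy y1).
apply: (derive_gt0_lt xy) => z /z01 ?.
  exact: ibeta_derive.
exact: beta_density_gt0.
Qed.

Lemma ibeta1_gt0 (R : realType) (b a : R) : 0 < b -> 0 < a -> 0 < ibeta b a 1.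
Proof.
move=> b0 a0; have h1 : 0 < 2^-1 :> R by rewrite invr_gt0.
have h2 : 2^-1 < 1 :> R by rewrite invf_lt1// ltr1n.
have h3 : 0 < 4^-1 :> R by rewrite invr_gt0.
have h4 : 4^-1 < 2^-1 :> R by rewrite ltf_pV2 ?posrE// ltr_nat.
apply: (@le_lt_trans _ _ (ibeta b a 4^-1)).
  apply: (cvgr_to_le (ibeta_cvg0 a0 b0)); near=> x.
  by apply/ltW/ibeta_increasing => //; apply: lt_trans h2.
apply: (@lt_le_trans _ _ (ibeta b a 2^-1)); first exact: ibeta_increasing.
apply: (cvgr_to_ge (ibeta_cvg1 a0 b0)); near=> x.
by apply/ltW/ibeta_increasing.
Unshelve. all: by end_near. Qed.

Section power_substitution.
Context {R : realType}.
Variables (b a r : R).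
Hypotheses (b0 : 0 < b) (a0 : 0 < a) (r01 : 0 < r <= 1).

Let r0 : 0 < r. Proof. by have /andP[] := r01. Qed.

Let slope (x : R) := r * ((1 - x `^ r) / (1 - x)) `^ (b - 1).

Lemma powR_itv01 (x : R) : 0 < x < 1 -> 0 < x `^ r < 1.
Proof.
move=> /andP[x0 x1]; rewrite powR_gt0//=.
have := @gt0_ltr_powR R r r0 x 1; rewrite powR1; apply => //.
  by rewrite nnegrE ltW.
by rewrite nnegrE.
Qed.

Let slope_ratio_gt0 (x : R) : 0 < x < 1 -> 0 < (1 - x `^ r) / (1 - x).
Proof.
move=> /[dup] /powR_itv01/andP[_ xr1] /andP[x0 x1].
by rewrite divr_gt0// subr_gt0.
Qed.

Let power_derive (x : R) : 0 < x < 1 ->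
  is_derive x 1 (fun x => ibeta b a (x `^ r)) (slope x * beta_density b (r * a) x).
Proof.
move=> /[dup] x01 /andP[x0 x1]; have xr := powR_itv01 x01.
have := is_derive1_comp (g := fun x => x `^ r) (ibeta_derive a0 b0 xr)
  (is_derive1_powR r x0).
have -> // : beta_density b a (x `^ r) * (r * x `^ (r - 1)) =
  slope x * beta_density b (r * a) x.
have /andP[xr0 xr1] := xr.
have -> : slope x = r * (1 - x `^ r) `^ (b - 1) / (1 - x) `^ (b - 1).
  rewrite /slope powRM ?subr_ge0 ?(ltW xr1) ?invr_ge0 ?subr_ge0 ?(ltW x1)//.
  by rewrite -powR_inv1 ?subr_ge0 ?(ltW x1)// powRAC powR_inv1 ?powR_ge0// mulrA.
rewrite /beta_density -powRrM.
have -> : x `^ (r * a - 1) = x `^ (r * (a - 1)) * x `^ (r - 1).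
  rewrite -powRD ?(gt_eqF x0) ?implybT//; congr (_ `^ _); ring.
have : (1 - x) `^ (b - 1) != 0 by rewrite gt_eqF// powR_gt0// subr_gt0.
by move=> ?; field.
Qed.

Let power_cvg0 : ibeta b a (x `^ r) @[x --> 0^'+] --> 0.
Proof.
apply/cvg_at_rightP => u [u0 cu].
have /cvg_at_rightP := ibeta_cvg0 a0 b0; apply; split=> [n|].
  by rewrite powR_gt0.
by have /cvg_at_rightP := powR_cvg0 r0; apply.
Qed.

Let power_cvg1 : ibeta b a (x `^ r) @[x --> 1^'-] --> ibeta b a 1.
Proof.
have powc : x `^ r @[x --> 1^'-] --> (1 : R).
  rewrite -[X in _ --> X](congr1 (@^~ r) (powR1 R)).
  by apply: cvg_at_left_filter; exact: powR_continuous.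
apply/cvgrPdist_le => e e0.
have /cvgrPdist_le/(_ e e0)[d /= d0 dP] := ibeta_cvg1 a0 b0.
near=> x; apply: dP => /=.
  by near: x; apply: cvgr_dist_lt.
have x01 : 0 < x < 1 by apply/andP; split.
by have /andP[] := powR_itv01 x01.
Unshelve. all: by end_near. Qed.

Lemma ibeta_power_ge (x : R) : 1 <= b -> 0 < x < 1 ->
  ibeta b a 1 * ibeta b (r * a) x <= ibeta b (r * a) 1 * ibeta b a (x `^ r).
Proof.
move=> b1 x01; have ra0 : 0 < r * a by rewrite mulr_gt0.
apply: (@ratio_noninc_le _ (ibeta b (r * a)) (fun x => ibeta b a (x `^ r))
  (beta_density b (r * a)) slope x _ _ x01 _ power_derive _ _ _ power_cvg0 _ power_cvg1).
- by move=> y y01; exact: ibeta_derive.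
- by move=> y /(beta_density_gt0 b (r * a))/ltW.
- move=> y z y0 yz z1; rewrite /slope ler_wpM2l ?(ltW r0)//.
  apply: ge0_ler_powR; rewrite ?subr_ge0// ?nnegrE.
  + by rewrite ltW// slope_ratio_gt0// (lt_le_trans y0 yz).
  + by rewrite ltW// slope_ratio_gt0// y0 (le_lt_trans yz).
  + exact: powR_chord_slope.
- exact: ibeta_cvg0.
- exact: ibeta_cvg1.
Qed.

Lemma ibeta_power_le (x : R) : b <= 1 -> 0 < x < 1 ->
  ibeta b (r * a) 1 * ibeta b a (x `^ r) <= ibeta b a 1 * ibeta b (r * a) x.
Proof.
move=> b1 x01; have ra0 : 0 < r * a by rewrite mulr_gt0.
apply: (@ratio_nondec_ge _ (ibeta b (r * a)) (fun x => ibeta b a (x `^ r))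
  (beta_density b (r * a)) slope x _ _ x01 _ power_derive _ _ _ power_cvg0 _ power_cvg1).
- by move=> y y01; exact: ibeta_derive.
- by move=> y /(beta_density_gt0 b (r * a))/ltW.
- move=> y z y0 yz z1; rewrite /slope ler_wpM2l ?(ltW r0)//.
  have y01 : 0 < y < 1 by rewrite y0 (le_lt_trans yz).
  have z01 : 0 < z < 1 by rewrite z1 (lt_le_trans y0 yz).
  rewrite -[b - 1]opprK opprB !powRN lef_pV2 ?posrE ?powR_gt0 ?slope_ratio_gt0//.
  apply: ge0_ler_powR; rewrite ?subr_ge0// ?nnegrE ?(ltW (slope_ratio_gt0 _))//.
  exact: powR_chord_slope.
- exact: ibeta_cvg0.
- exact: ibeta_cvg1.
Qed.

End power_substitution.

Section quantile_monotone.
Context {R : realType}.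
Variables (p b : R) (q : R -> R).
Hypotheses (b0 : 0 < b) (q01 : forall a, 0 < a -> 0 < q a < 1).
Hypothesis qE : forall a, 0 < a -> ibeta b a (q a) = p * ibeta b a 1.

Let q_pow (a a' : R) : 0 < a -> a <= a' ->
  0 < a / a' <= 1 /\ a / a' * a' = a /\ 0 < q a `^ (a / a') < 1.
Proof.
move=> a0 aa'; have a'0 : 0 < a' by exact: lt_le_trans aa'.
have r01 : 0 < a / a' <= 1.
  by rewrite divr_gt0//= ler_pdivrMr// mul1r.
split => //; split; first by rewrite divfK// gt_eqF.
by apply: powR_itv01 => //; exact: q01.
Qed.

Let ln_pow (a a' : R) : 0 < a' -> a' * ln (q a `^ (a / a')) = a * ln (q a).
Proof. by move=> a'0; rewrite ln_powR mulrA mulrCA divff ?gt_eqF// mulr1. Qed.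

Lemma quantile_nondecreasing (a a' : R) : 1 <= b -> 0 < a -> a <= a' ->
  - a * ln (q a) <= - a' * ln (q a').
Proof.
move=> b1 a0 aa'; have a'0 : 0 < a' by exact: lt_le_trans aa'.
have [r01 [raE /andP[qr0 qr1]]] := q_pow a0 aa'.
have /andP[q'0 q'1] := q01 a'0.
have := ibeta_power_ge b0 a'0 r01 b1 (q01 a0).
rewrite raE qE// mulrCA [leLHS]mulrA [leLHS]mulrC ler_pM2l ?ibeta1_gt0// -qE// => le1.
rewrite !mulNr lerN2 -(ln_pow a a'0) ler_pM2l// ler_ln ?posrE//.
rewrite leNgt; apply/negP => lt1; move: le1; rewrite leNgt => /negP; apply.
exact: ibeta_increasing.
Qed.

Lemma quantile_nonincreasing (a a' : R) : b <= 1 -> 0 < a -> a <= a' ->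
  - a' * ln (q a') <= - a * ln (q a).
Proof.
move=> b1 a0 aa'; have a'0 : 0 < a' by exact: lt_le_trans aa'.
have [r01 [raE /andP[qr0 qr1]]] := q_pow a0 aa'.
have /andP[q'0 q'1] := q01 a'0.
have := ibeta_power_le b0 a'0 r01 b1 (q01 a0).
rewrite raE qE// [leRHS]mulrCA [leRHS]mulrA [leRHS]mulrC ler_pM2l ?ibeta1_gt0// -qE// => le1.
rewrite !mulNr lerN2 -(ln_pow a a'0) ler_pM2l// ler_ln ?posrE//.
rewrite leNgt; apply/negP => lt1; move: le1; rewrite leNgt => /negP; apply.
exact: ibeta_increasing.
Qed.

End quantile_monotone.

(** * Comparisons for small and large parameters *)

(** Bernoulli's inequality for the integer exponent [n], which bounds the power from
    below because [z <= 1]; a negative [c] is reduced to [- c] by factoring out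
    [z `^ c]. *)
Lemma powR_sub1_le (R : realType) (z c : R) (n : nat) : 0 < z <= 1 ->
  `|c| <= n%:R -> `|z `^ c - 1| <= n%:R * (1 - z) * Num.max 1 (z `^ c).
Proof.
move=> /andP[z0 z1] cn.
have bern m : 1 - z ^+ m <= m%:R * (1 - z).
  elim: m => [|m IHm]; first by rewrite expr0 subrr mul0r.
  rewrite exprS -natr1 mulrDl mul1r.
  have := ler_wpM2l (ltW z0) IHm; have := ler_wpM2r (mulr_ge0 (ler0n R m) _) z1.
  move=> /(_ (1 - z)); rewrite subr_ge0 => /(_ z1).
  by rewrite mulrBr mulr1 => h1 h2; lra.
have nonneg (d : R) : 0 <= d <= n%:R -> 0 <= 1 - z `^ d <= n%:R * (1 - z).
  move=> /andP[d0 dn]; apply/andP; split.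
    rewrite subr_ge0 -[leRHS](powRr0 z); apply: ger_powR => //.
    by rewrite z0.
  apply: le_trans (bern n); rewrite lerD2l lerN2 -powR_mulrn ?(ltW z0)//.
  by apply: ger_powR => //; rewrite z0.
have nz0 : 0 <= n%:R * (1 - z) by rewrite mulr_ge0// subr_ge0.
have [c0|c0] := leP 0 c.
  have /andP[h1 h2] : 0 <= 1 - z `^ c <= n%:R * (1 - z).
    by apply: nonneg; rewrite c0 (le_trans (ler_norm c)).
  rewrite distrC ger0_norm// (le_trans h2)// ler_peMr//.
  by rewrite le_max lexx.
have /andP[h1 h2] : 0 <= 1 - z `^ (- c) <= n%:R * (1 - z).
  by apply: nonneg; rewrite oppr_ge0 (ltW c0) (le_trans (ler_norm _))// normrN.
have zc0 : 0 < z `^ c by rewrite powR_gt0.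
have -> : z `^ c - 1 = z `^ c * (1 - z `^ (- c)).
  by rewrite mulrBr mulr1 -powRD ?subrr ?powRr0// (gt_eqF z0) implybT.
rewrite ger0_norm ?mulr_ge0 ?(ltW zc0)// mulrC.
apply: ler_pM => //; first exact: ltW.
by rewrite le_max lexx orbT.
Qed.

(** For small [a] the mass sits near [0], where the factor [(1 - t) `^ (b - 1)] is close
    to [1]. The derivative of [a * ibeta b a x - x `^ a] is at most, in absolute value,
    [a * n] times that of a bounded function [E] that does not depend on [a]. *)
Lemma ibeta_small_shape (R : realType) (b : R) : 0 < b ->
  exists C : R, 0 <= C /\ forall a x : R, 0 < a -> 0 < x < 1 ->
    `|a * ibeta b a x - x `^ a| <= a * C /\ `|a * ibeta b a 1 - 1| <= a * C.
Proof.
move=> b0.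
pose n := (Num.truncn `|b - 1|).+1.
have bn : `|b - 1| <= n%:R by exact/ltW/truncnS_gt.
exists (n%:R * (1 + b^-1)); split; first by rewrite mulr_ge0// addr_ge0// invr_ge0 ltW.
move=> a u a0 u01.
(* The primitive of [1 + (1 - x) `^ (b - 1)]; it stays between [- b^-1] and [1]. *)
pose E (x : R) := x - b^-1 * (1 - x) `^ b.
have dE (x : R) : 0 < x < 1 -> is_derive x 1 E (1 + (1 - x) `^ (b - 1)).
  move=> /andP[x0 x1].
  apply: (is_derive_eq (is_deriveB (is_derive_id x 1)
    (is_deriveZ b^-1 (is_derive_powR_onem b x1)))).
  by rewrite /GRing.scale/= mulrN opprK mulrA mulVf ?mul1r// gt_eqF.
(* [D] is monotone for [s = a * n] and for [s = - (a * n)], in opposite senses. *)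
pose D (s x : R) := a * ibeta b a x - x `^ a + s * E x.
have dD (s x : R) : 0 < x < 1 -> is_derive x 1 (D s)
    (a * x `^ (a - 1) * ((1 - x) `^ (b - 1) - 1) + s * (1 + (1 - x) `^ (b - 1))).
  move=> /[dup] x01' /andP[x0 x1].
  apply: (is_derive_eq (is_deriveD (is_deriveB (is_deriveZ a (ibeta_derive a0 b0 x01'))
    (is_derive1_powR a x0)) (is_deriveZ s (dE x x01')))).
  by rewrite /GRing.scale/= /beta_density; ring.
have bound (x : R) : 0 < x < 1 -> `|a * x `^ (a - 1) * ((1 - x) `^ (b - 1) - 1)| <=
    a * n%:R * (1 + (1 - x) `^ (b - 1)).
  move=> /andP[x0 x1]; have z01 : 0 < 1 - x <= 1 by rewrite subr_gt0 x1 gerBl ltW.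
  rewrite normrM ger0_norm ?mulr_ge0 ?powR_ge0 ?(ltW a0)//.
  have := powR_sub1_le z01 bn; rewrite opprB subrKC => h.
  apply: (le_trans (ler_wpM2l _ h)); first by rewrite mulr_ge0 ?powR_ge0 ?ltW.
  have xa : x * x `^ (a - 1) <= 1.
    rewrite mulr_powRB1 ?(ltW x0)// -[leRHS](powRr0 x); apply: ger_powR.
      by rewrite x0 ltW.
    exact: ltW.
  have -> : a * x `^ (a - 1) * (n%:R * x * Num.max 1 ((1 - x) `^ (b - 1))) =
     a * n%:R * (x * x `^ (a - 1) * Num.max 1 ((1 - x) `^ (b - 1))) by ring.
  apply: ler_wpM2l; first by rewrite mulr_ge0// ltW.
  have m0 : 0 <= Num.max 1 ((1 - x) `^ (b - 1)) by rewrite le_max ler01.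
  apply: (le_trans (ler_wpM2r m0 xa)); rewrite mul1r ge_max.
  by rewrite lerDl powR_ge0 lerDr ler01.
have Eb (x : R) : 0 < x < 1 -> E x <= 1.
  move=> /andP[x0 x1]; rewrite /E.
  have : 0 <= b^-1 * (1 - x) `^ b by rewrite mulr_ge0 ?powR_ge0 ?invr_ge0 ?ltW.
  by lra.
have D0 s : D s x @[x --> 0^'+] --> s * - b^-1.
  have -> : s * - b^-1 = a * 0 - 0 + s * (0 - b^-1 * 1) by ring.
  apply: cvgD; first apply: cvgB.
  - by apply: cvgMr; exact: ibeta_cvg0.
  - exact: powR_cvg0.
  - apply: cvgMr; apply: cvg_at_right_filter; apply: cvgB; first exact: cvg_id.
    apply: cvgMr; rewrite -[X in _ --> X](congr1 (@^~ b) (powR1 R)).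
    rewrite -[X in _ --> X `^ _](subr0 1).
    exact: powR_onem_continuous.
have main (y : R) : 0 < y < 1 -> `|a * ibeta b a y - y `^ a| <= a * (n%:R * (1 + b^-1)).
  move=> /[dup] y01 /andP[y0 y1].
  have yz t z : 0 < t -> t <= z <= y -> 0 < z < 1.
    by move=> t0 /andP[tz zy]; rewrite (lt_le_trans t0 tz) (le_lt_trans zy).
  have an0 : 0 <= a * n%:R by rewrite mulr_ge0// ltW.
  have Ey := ler_wpM2l an0 (Eb y y01).
  rewrite ler_norml; apply/andP; split.
    have : a * n%:R * - b^-1 <= D (a * n%:R) y.
      apply: (cvgr_to_le (D0 _)); near=> t.
      have t0 : 0 < t by [].
      have ty : t <= y by near: t; exact: nbhs_right_le.
      apply: (derive_ge0_le ty) => z /(yz t z t0) z01; first exact: dD.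
      by have := bound z z01; rewrite ler_norml => /andP[h _]; rewrite /= -lerBlDr sub0r.
    by move: Ey; rewrite /D; lra.
  have : D (- (a * n%:R)) y <= - (a * n%:R) * - b^-1.
    apply: (cvgr_to_ge (D0 _)); near=> t.
    have t0 : 0 < t by [].
    have ty : t <= y by near: t; exact: nbhs_right_le.
    apply: (derive_le0_ge ty) => z /(yz t z t0) z01; first exact: dD.
    by have := bound z z01; rewrite ler_norml /= mulNr subr_le0 => /andP[].
  by move: Ey; rewrite /D; lra.
split; first exact: main.
have c1 : `|a * ibeta b a y - y `^ a| @[y --> 1^'-] --> `|a * ibeta b a 1 - 1|.
  apply: cvg_norm; apply: cvgB; first by apply: cvgMr; exact: ibeta_cvg1.
  rewrite -[X in _ --> X](congr1 (@^~ a) (powR1 R)).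
  by apply: cvg_at_left_filter; exact: powR_continuous.
apply: (cvgr_to_le c1); near=> y; apply: main; apply/andP; split => //.
Unshelve. all: by end_near. Qed.

Lemma ler_norm_diff_scaled (R : realDomainType) (p u v e : R) : 0 <= p <= 1 ->
  `|u| <= e -> `|v| <= e -> `|u - p * v| <= 2 * e.
Proof.
move=> /andP[p0 p1] ue ve; apply: le_trans (ler_normB _ _) _.
rewrite mulr_natl mulr2n lerD// normrM (ger0_norm p0) -[leRHS]mul1r.
exact: ler_pM.
Qed.

(** Replacing [a * ibeta b a x] by [x `^ a] in the equation of the quantile costs
    [O(a)], so [q a `^ a] tends to [p]. *)
Lemma quantile_cvg0 (R : realType) (p b : R) (q : R -> R) : 0 < p < 1 -> 0 < b ->
  (forall a, 0 < a -> 0 < q a < 1) ->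
  (forall a, 0 < a -> ibeta b a (q a) = p * ibeta b a 1) ->
  - a * ln (q a) @[a --> 0^'+] --> - ln p.
Proof.
move=> /andP[p0 p1] b0 q01 qE.
have [C [C0 CP]] := ibeta_small_shape b0.
have C20 : 0 < 2 * C + 1 by rewrite ltr_wpDl ?mulr_ge0.
have cq : q a `^ a @[a --> 0^'+] --> p.
  apply/cvgrPdist_le => e e0; near=> a.
  have a0 : 0 < a by [].
  have [h1 h2] := CP a (q a) a0 (q01 a a0).
  apply: (@le_trans _ _ (a * (2 * C))); last first.
    apply: (@le_trans _ _ (a * (2 * C + 1))).
      by rewrite ler_wpM2l ?(ltW a0)// lerDl.
    rewrite -ler_pdivlMr//; near: a; apply: nbhs_right_le.
    exact: divr_gt0.
  have -> : p - q a `^ a = (a * ibeta b a (q a) - q a `^ a) - p * (a * ibeta b a 1 - 1).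
    by rewrite qE//; ring.
  by rewrite mulrCA; apply: ler_norm_diff_scaled => //; rewrite !ltW.
have cln : ln (q a `^ a) @[a --> 0^'+] --> ln p.
  exact: (@cvg_comp _ _ _ (fun a => q a `^ a) (@ln R) _ _ _ cq (continuous_ln p0)).
rewrite (_ : (fun a => - a * ln (q a)) = (fun a => - ln (q a `^ a))).
  exact: cvgN.
by apply/funext => a; rewrite ln_powR mulNr.
Unshelve. all: by end_near. Qed.

Lemma igamma_increasing (R : realType) (b x y : R) : 0 < b -> 0 < x -> x < y ->
  igamma b x < igamma b y.
Proof.
move=> b0 x0 xy; apply: (derive_gt0_lt xy) => z /andP[xz _].
  by apply: igamma_derive => //; exact: lt_le_trans xz.
by apply: gamma_density_gt0; exact: lt_le_trans xz.
Qed.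

Lemma igamma_ge0 (R : realType) (b x : R) : 0 <= igamma b x.
Proof.
apply: Rintegral_ge0 => s; rewrite /= in_itv/= => /andP[s0 _].
exact/ltW/gamma_density_gt0.
Qed.

Lemma igamma_le_gamma (R : realType) (b x : R) : 0 < b -> 0 < x ->
  igamma b x <= gamma_fun b.
Proof.
move=> b0 x0; apply: (cvgr_to_ge (igamma_cvgy b0)); near=> y.
apply/ltW/igamma_increasing => //; near: y; apply: nbhs_pinfty_gt.
exact: num_real.
Unshelve. all: by end_near. Qed.

Lemma gamma_fun_gt0 (R : realType) (b : R) : 0 < b -> 0 < gamma_fun b.
Proof.
move=> b0; apply: (@lt_le_trans _ _ (igamma b 2)); last exact: igamma_le_gamma.
by apply: (le_lt_trans (igamma_ge0 b 1)); apply: igamma_increasing => //; rewrite ltr1n.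
Qed.

Lemma gamma_densityS (R : realType) (b y : R) : 0 < b -> 0 < y ->
  gamma_density (b + 1) y = y * gamma_density b y.
Proof.
by move=> b0 y0; rewrite /gamma_density addrK mulrCA mulr_powRB1// ltW.
Qed.

(** With [t = expR (- (y / a))] the factor [1 - t] is [(y / a) * psi (y / a)], where
    [psi] is close to [1] near [0]. The resulting error in the density is at most
    [n / a] times the gamma density with parameter [b + 1], which is integrable. *)
Lemma ibeta_large_shape (R : realType) (b : R) : 0 < b ->
  exists C : R, 0 <= C /\ forall a y : R, 0 < a -> 0 < y ->
    `|a `^ b * ibeta b a (expR (- (y / a))) + igamma b y - gamma_fun b| <= C / a /\
    `|a `^ b * ibeta b a 1 - gamma_fun b| <= C / a.
Proof.
move=> b0.
have b10 : 0 < b + 1 by rewrite addr_gt0.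
pose n := (Num.truncn `|b - 1|).+1.
have bn : `|b - 1| <= n%:R by exact/ltW/truncnS_gt.
have G10 := gamma_fun_gt0 b10.
exists (n%:R * gamma_fun (b + 1)); split; first by rewrite mulr_ge0// ltW.
move=> a u a0 u0.
have ia0 : 0 < a^-1 by rewrite invr_gt0.
(* [(1 - psi x) / psi x <= x] amounts to [1 + x <= expR x]. *)
pose psi (x : R) : R := (1 - expR (- x)) / x.
have psi01 (x : R) : 0 < x -> 0 < psi x <= 1 /\ (1 - psi x) / psi x <= x.
  move=> x0; have /andP[e0 e1] := expRN_lt1 x0.
  have p0 : 0 < psi x by rewrite divr_gt0// subr_gt0.
  rewrite p0/=; split.
    rewrite ler_pdivrMr// mul1r lerBlDl -lerBlDr.
    by have := expR_ge1Dx (- x).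
  rewrite ler_pdivrMr// lerBlDr -[X in X + _]mulr1 -[X in _ + X]mul1r.
  rewrite mul1r mulr1 -[X in _ <= _ + X]mul1r -mulrDl.
  rewrite /psi mulrA ler_pdivlMr// mul1r mulrBr mulr1.
  have h : expR (- x) * (1 + x) <= 1.
    by rewrite expRN ler_pdivrMl ?expR_gt0// mulr1; exact: expR_ge1Dx.
  by move: h; lra.
pose H (y : R) := a `^ b * ibeta b a (expR (- (y / a))).
have dH (y : R) : 0 < y ->
    is_derive y 1 H (- (gamma_density b y * psi (y / a) `^ (b - 1))).
  move=> y0; have ya0 : 0 < y / a by rewrite divr_gt0.
  have d1 : is_derive y 1 (fun y : R => y / a) a^-1.
    by apply: is_derive_eq; rewrite /GRing.scale/=; ring.
  have d2 := is_derive1_comp (g := fun y : R => y / a) (ibeta_log_derive b0 a0 ya0) d1.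
  apply: (is_derive_eq (is_deriveZ (a `^ b) d2)); rewrite /GRing.scale/=.
  rewrite /log_density /gamma_density (_ : a * (y / a) = y); last first.
    by rewrite mulrCA divff ?mulr1// gt_eqF.
  have /andP[e0 e1] := expRN_lt1 ya0.
  have -> : 1 - expR (- (y / a)) = y * a^-1 * psi (y / a).
    by rewrite /psi mulrCA divff ?mulr1// gt_eqF.
  have /andP[ps0 _] := (psi01 _ ya0).1.
  have -> : (y * a^-1 * psi (y / a)) `^ (b - 1) =
      y `^ (b - 1) * a^-1 `^ (b - 1) * psi (y / a) `^ (b - 1).
    move: (psi _) ps0 => z z0.
    by rewrite !powRM ?mulr_ge0 ?(ltW y0) ?(ltW ia0) ?(ltW z0).
  rewrite -[a^-1 `^ _](_ : a `^ (- 1 * (b - 1)) = _); last first.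
    by rewrite powRrM powR_inv1// ltW.
  have -> : a `^ b = a `^ 1 * a `^ (b - 1).
    by rewrite -powRD ?(gt_eqF a0) ?implybT// subrKC.
  rewrite mulN1r powRN powRr1 ?(ltW a0)//.
  have : a `^ (b - 1) != 0 by rewrite gt_eqF// powR_gt0.
  have : a != 0 by rewrite gt_eqF.
  by move=> ? ?; field; apply/andP.
have bound (y : R) : 0 < y ->
    `|gamma_density b y * (1 - psi (y / a) `^ (b - 1))| <=
    n%:R / a * gamma_density (b + 1) y.
  move=> y0; have ya0 : 0 < y / a by rewrite divr_gt0.
  have [/[dup] ps01 /andP[ps0 ps1] ps2] := psi01 _ ya0.
  have g0 := gamma_density_gt0 b y0.
  rewrite normrM (gtr0_norm g0) gamma_densityS// distrC.
  have -> : n%:R / a * (y * gamma_density b y) = gamma_density b y * (n%:R * (y / a)) by ring.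
  rewrite ler_wpM2l ?(ltW g0)//; apply: (le_trans (powR_sub1_le ps01 bn)).
  rewrite -mulrA ler_wpM2l//; apply: le_trans ps2.
  rewrite ler_wpM2l ?subr_ge0// ge_max; apply/andP; split.
    by rewrite invf_ge1.
  rewrite -[leRHS]powR_inv1 ?(ltW ps0)//; apply: (@ger_powR R _ ps01).
  by rewrite lerBrDr addNr ltW.
have ea0 : 0 <= n%:R / a by rewrite divr_ge0// ltW.
(* [D] is monotone for [s = n / a] and for [s = - (n / a)], in opposite senses; its
   limits at infinity are known. *)
pose D (s y : R) := H y + igamma b y + s * igamma (b + 1) y.
have dD (s y : R) : 0 < y -> is_derive y 1 (D s)
    (gamma_density b y * (1 - psi (y / a) `^ (b - 1)) + s * gamma_density (b + 1) y).
  move=> y0; apply: (is_derive_eq (is_deriveD (is_deriveD (dH y y0) (igamma_derive b0 y0))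
    (is_deriveZ s (igamma_derive b10 y0)))).
  by rewrite /GRing.scale/=; ring.
have Hy : H y @[y --> +oo] --> 0.
  rewrite -(mulr0 (a `^ b)); apply: cvgMr; apply/cvg_pinftyP => v vy.
  have /cvg_at_rightP := ibeta_cvg0 a0 b0; apply; split=> [m|]; first exact: expR_gt0.
  have /cvg_pinftyP := @cvgr_expR R; apply.
  apply/cvgryPge => A; near=> m.
  rewrite ler_pdivlMr//; near: m; by move/cvgryPge : vy; exact.
have Dy s : D s y @[y --> +oo] --> gamma_fun b + s * gamma_fun (b + 1).
  rewrite -[gamma_fun b in X in _ --> X]add0r; apply: cvgD; first apply: cvgD => //.
    exact: igamma_cvgy.
  by apply: cvgMr; exact: igamma_cvgy.
have main (y : R) : 0 < y -> `|H y + igamma b y - gamma_fun b| <= n%:R * gamma_fun (b + 1) / a.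
  move=> y0; have Lge : 0 <= n%:R / a * igamma (b + 1) y by rewrite mulr_ge0// igamma_ge0.
  have Dge : gamma_fun b + - (n%:R / a) * gamma_fun (b + 1) <= D (- (n%:R / a)) y.
    apply: (cvgr_to_le (Dy _)); near=> t.
    have yt : y <= t by near: t; apply: nbhs_pinfty_ge; exact: num_real.
    apply: (derive_le0_ge yt) => z /andP[yz _]; have z0 := lt_le_trans y0 yz.
      exact: dD.
    by have := bound z z0; rewrite ler_norml /= mulNr subr_le0 => /andP[].
  have Dle : D (n%:R / a) y <= gamma_fun b + n%:R / a * gamma_fun (b + 1).
    apply: (cvgr_to_ge (Dy _)); near=> t.
    have yt : y <= t by near: t; apply: nbhs_pinfty_ge; exact: num_real.
    apply: (derive_ge0_le yt) => z /andP[yz _]; have z0 := lt_le_trans y0 yz.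
      exact: dD.
    by have := bound z z0; rewrite ler_norml => /andP[h _]; rewrite /= -lerBlDr sub0r.
  move: Dge Dle Lge; rewrite /D !mulNr [n%:R * _ / a]mulrAC ler_norml.
  move: (H y) (igamma b y) (gamma_fun b) (_ * igamma _ _) (_ * gamma_fun _).
  by move=> h i g m M h1 h2 h3; apply/andP; split; lra.
split; first exact: main.
have c0 : `|H y + igamma b y - gamma_fun b| @[y --> 0^'+] -->
    `|a `^ b * ibeta b a 1 - gamma_fun b|.
  apply: cvg_norm; apply: cvgB; last exact: cvg_cst.
  rewrite -[X in _ --> X]addr0; apply: cvgD; last exact: igamma_cvg0.
  apply: cvgMr; apply/cvg_at_rightP => v [v0 cv].
  have /cvg_at_leftP := ibeta_cvg1 a0 b0; apply; split=> [m|].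
    by rewrite expR_lt1 oppr_lt0 divr_gt0.
  rewrite -[X in _ --> X]expR0.
  apply: (@continuous_cvg _ _ _ _ _ (fun n => - (v n / a)) (@expR R)).
    exact: continuous_expR.
  by rewrite -oppr0 -(mul0r a^-1); apply: cvgN; exact: cvgMl.
apply: (cvgr_to_le c0); near=> y; exact: main.
Unshelve. all: by end_near. Qed.

(** * The gamma quantile and the theorem *)

(** [g] is positive because the distribution gives no mass to the negative half line,
    while [r] is positive. *)
Lemma gamma_quantile (R : realType) (b r g : R) : 0 < b -> 0 < r ->
  is_quantile (gamma_prob b) r g -> 0 < g /\ igamma b g = r * gamma_fun b.
Proof.
move=> b0 r0; rewrite /is_quantile /gamma_prob.
have G0 := gamma_fun_gt0 b0.
have [g0 e|g0] := leP g 0.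
  have : (\int[@lebesgue_measure R]_(x in `]-oo, g]) (gamma_pdf b x)%:E)%E = 0%E.
    apply: integral0_eq => x /=; rewrite in_itv/= => xg.
    by rewrite /gamma_pdf ltNge (le_trans xg g0).
  by rewrite e => /eqP; rewrite eqe gt_eqF.
have pdfE : (fun x => (gamma_pdf b x)%:E) =
    (fun x => (gamma_density b x / gamma_fun b)%:E) \_ `]0, +oo[.
  apply/funext => x; rewrite /gamma_pdf patchE.
  case: ifPn => x0; first by rewrite mem_set//= in_itv/= x0.
  by rewrite memNset//= in_itv/= andbT; exact/negP.
rewrite pdfE -integral_mkcondr.
have -> : `]-oo, g] `&` `]0, +oo[ = `]0, g]%classic :> set R.
  apply/seteqP; split=> x /=; rewrite !in_itv/= andbT.
    by move=> [-> ->].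
  by move=> /andP[-> ->].
have ig : (@lebesgue_measure R).-integrable `]0, g[ (EFin \o gamma_density b).
  by apply: integrableS (gamma_density_integrable b0) => //; exact: subset_itvl.
have mg := measurable_int _ ig.
have mg' : measurable_fun `]0, g] (EFin \o gamma_density b).
  by apply/emeasurable_fun_itv_bndo_bndcP.
under eq_integral do rewrite mulrC EFinM.
rewrite ge0_integralZl_EFin//; last 2 first.
- by move=> x /=; rewrite in_itv/= lee_fin => /andP[x0 _]; exact/ltW/gamma_density_gt0.
- by rewrite invr_ge0 ltW.
rewrite -integral_itv_bndo_bndc//.
have -> : (\int[@lebesgue_measure R]_(x in `]0%R, g[) (gamma_density b x)%:E)%E =
    (igamma b g)%:E.
  by rewrite /igamma /Rintegral fineK//; exact: integrable_fin_num.
move=> [e]; split => //.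
by rewrite -e mulrAC mulVf ?mul1r// gt_eqF.
Qed.

(** By [ibeta_large_shape], [igamma b (phi a)] tends to [igamma b g]; strict
    monotonicity of [igamma b] brings this back to [phi a]. *)
Lemma quantile_cvgy (R : realType) (p b g : R) (q : R -> R) : 0 < p < 1 -> 0 < b ->
  (forall a, 0 < a -> 0 < q a < 1) ->
  (forall a, 0 < a -> ibeta b a (q a) = p * ibeta b a 1) ->
  0 < g -> igamma b g = (1 - p) * gamma_fun b ->
  - a * ln (q a) @[a --> +oo] --> g.
Proof.
move=> /andP[p0 p1] b0 q01 qE g0 gE.
have [C [C0 CP]] := ibeta_large_shape b0.
pose phi (a : R) := - a * ln (q a).
have phi_gt0 (a : R) : 0 < a -> 0 < phi a.
  by move=> a0; rewrite /phi mulNr -mulrN mulr_gt0// oppr_gt0 ln_lt0// q01.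
have phiP (a : R) : 0 < a -> `|igamma b (phi a) - igamma b g| <= 2 * C / a.
  move=> a0; have /andP[qa0 qa1] := q01 a a0.
  have [h1 h2] := CP a (phi a) a0 (phi_gt0 a a0).
  move: h1; have -> : - (phi a / a) = ln (q a).
    by rewrite /phi; field; rewrite gt_eqF.
  rewrite lnK ?posrE// qE// => h1.
  have -> : igamma b (phi a) - igamma b g =
      (a `^ b * (p * ibeta b a 1) + igamma b (phi a) - gamma_fun b) -
      p * (a `^ b * ibeta b a 1 - gamma_fun b) by rewrite gE; ring.
  by rewrite -mulrA; apply: ler_norm_diff_scaled => //; rewrite !ltW.
have cphi : igamma b (phi a) @[a --> +oo] --> igamma b g.
  apply/cvgrPdist_le => e e0; near=> a.
  have a0 : 0 < a by near: a; apply: nbhs_pinfty_gt; exact: num_real.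
  rewrite distrC; apply: le_trans (phiP a a0) _.
  rewrite ler_pdivrMr// [e * a]mulrC -ler_pdivrMr//.
rewrite -/phi; apply/cvgrPdist_le => e e0.
have ge0 : 0 < g + e by rewrite addr_gt0.
have up : \forall a \near +oo, phi a <= g + e.
  have := igamma_increasing b0 g0 (_ : g < g + e); rewrite ltrDl => /(_ e0) lt1.
  near=> a; have a0 : 0 < a by near: a; apply: nbhs_pinfty_gt; exact: num_real.
  have : igamma b (phi a) < igamma b (g + e) by near: a; exact: (cvgr_lt _ cphi).
  rewrite leNgt => h; apply/negP => lt2; move: h; apply/negP; rewrite -leNgt.
  exact/ltW/igamma_increasing.
have down : \forall a \near +oo, g - e <= phi a.
  have [ge|eg] := leP (g - e) 0.
    near=> a; apply: (le_trans ge); apply/ltW/phi_gt0.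
    by near: a; apply: nbhs_pinfty_gt; exact: num_real.
  have := igamma_increasing b0 eg (_ : g - e < g); rewrite gtrBl => /(_ e0) lt1.
  near=> a; have a0 : 0 < a by near: a; apply: nbhs_pinfty_gt; exact: num_real.
  have : igamma b (g - e) < igamma b (phi a) by near: a; exact: (cvgr_gt _ cphi).
  rewrite leNgt => h; apply/negP => lt2; move: h; apply/negP; rewrite -leNgt.
  apply/ltW/igamma_increasing => //; exact: phi_gt0.
near=> a; rewrite ler_distlC; apply/andP; split.
  by near: a.
by near: a.
Unshelve. all: by end_near. Qed.

Theorem proposition1p3 (R : realType) (p b : R)
    (hp : 0 < p < 1) (hb : 0 < b)
    (q : R -> R)
    (hq01 : forall a : R, 0 < a -> 0 < q a < 1)
    (hq : forall a : R, 0 < a ->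
      incomplete_beta a b (q a) = (p%:E * incomplete_beta a b 1)%E)
    (gamma_b : R) (hgamma : is_quantile (gamma_prob b) (1 - p) gamma_b) :
  let phi := fun a : R => - a * ln (q a) in
  real_analytic_on `]0, +oo[ phi /\
  (b < 1 -> {in `]0, +oo[ &, nonincreasing_fun phi}) /\
  (b = 1 -> exists c : R, forall a : R, 0 < a -> phi a = c) /\
  (1 < b -> {in `]0, +oo[ &, nondecreasing_fun phi}) /\
  phi a @[a --> 0^'+] --> - ln p /\
  phi a @[a --> +oo] --> gamma_b.
Proof.
move=> phi.
have qE a : 0 < a -> ibeta b a (q a) = p * ibeta b a 1.
  move=> a0; have := hq a a0.
  rewrite !ibeta_fineK//; first by case.
  by have /andP[_ /ltW] := hq01 a a0.
have noninc a a' : b <= 1 -> 0 < a -> a <= a' -> phi a' <= phi a.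
  by move=> b1 a0 aa'; exact: (quantile_nonincreasing hb hq01 qE).
have nondec a a' : 1 <= b -> 0 < a -> a <= a' -> phi a <= phi a'.
  by move=> b1 a0 aa'; exact: (quantile_nondecreasing hb hq01 qE).
split; first exact: quantile_analytic hb hq01 qE.
split.
  move=> /ltW b1 x y; rewrite !in_itv/= !andbT => x0 y0 xy.
  exact: noninc.
split.
  move=> b1; exists (phi 1) => a a0.
  have [b1l b1r] : b <= 1 /\ 1 <= b by rewrite b1.
  apply/eqP; rewrite eq_le; apply/andP.
  have [a1|/ltW a1] := leP a 1; first by split; [exact: nondec|exact: noninc].
  by split; [exact: noninc|exact: nondec].
split.
  move=> /ltW b1 x y; rewrite !in_itv/= !andbT => x0 y0 xy.
  exact: nondec.
split; first exact: quantile_cvg0 hp hb hq01 qE.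
have p10 : 0 < 1 - p by rewrite subr_gt0; have /andP[] := hp.
have [g0 gE] := gamma_quantile hb p10 hgamma.
exact: quantile_cvgy hp hb hq01 qE g0 gE.
Qed.
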